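(* Let $a(z)$ be a function meromorphic in the disk $\{z\in\mathbb{C}: |z|<R\}$ and analytic at the origin, having in this disk precisely $\lambda\ge 1$ poles counted with multiplicity. Let $\pi_{n,\lambda-1}(z)$, $n=0,1,2,\ldots$, be the Padé approximants of $a(z)$ with numerator degree at most $n$ and denominator degree at most $\lambda-1$, and let $\mathbb{U}_{\mathbb{F}}$ be the open set associated with $a(z)$ that is defined in the context. Then the sequence $\pi_{n,\lambda-1}(z)$ converges to $a(z)$, as $n\to\infty$, uniformly on compact subsets of $\mathbb{U}_{\mathbb{F}}$.
   Context: Padé approximants. For $n,m\ge 0$, the Padé approximant of type $(n,m)$ of $a(z)$ (with respect to its Taylor series at $0$) is the rational function $\pi_{n,m}=P_{n,m}/Q_{n,m}$, where $P_{n,m},Q_{n,m}$ are polynomials with $\deg P_{n,m}\le n$, $\deg Q_{n,m}\le m$, $Q_{n,m}\not\equiv 0$, and $a(z)Q_{n,m}(z)-P_{n,m}(z)=O(z^{n+m+1})$ as $z\to 0$. The $m$th row of the Padé table is the sequence $\{\pi_{n,m}\}_{n\ge 0}$. Poles. Let $z_1,\ldots,z_\ell$ be the distinct poles of $a(z)$ in $\{|z|<R\}$, of multiplicities $s_1,\ldots,s_\ell$ respectively, so that $\lambda=s_1+\cdots+s_\ell$. They are numbered so that $$\rho:=|z_1|=\cdots=|z_\mu|>|z_{\mu+1}|\ge\cdots\ge|z_\ell|,$$ and the poles of maximal modulus are ordered so that $$s_1=\cdots=s_\nu>s_{\nu+1}\ge\cdots\ge s_\mu,\qquad 1\le\nu\le\mu\le\ell.$$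 The poles $z_1,\ldots,z_\nu$ are called the dominant poles. Write $z_j=\rho e^{2\pi i\Theta_j}$ with $\Theta_j\in\mathbb{R}$ for $j=1,\ldots,\nu$. Let $\mathcal{D}_\rho=\{z\in\mathbb{C}:|z|<\rho\}$. The group $\mathbb{F}$. Let $\mathbb{T}=\{z\in\mathbb{C}:|z|=1\}$ and $\xi=(e^{2\pi i\Theta_1},\ldots,e^{2\pi i\Theta_\nu})\in\mathbb{T}^\nu$. $\mathbb{F}$ denotes the closure in the torus $\mathbb{T}^\nu$ (a compact abelian group under coordinatewise multiplication) of the cyclic group $\{\xi^n\}_{n\in\mathbb{Z}}$. The constants $C_j$. Let $D(z)=(z-z_1)^{s_1}\cdots(z-z_\ell)^{s_\ell}$ and $D_j(z)=D(z)/(z-z_j)^{s_j}$. Let $A_j$ be the coefficient of $(z-z_j)^{-s_j}$ in the Laurent series of $a(z)$ in a neighborhood of $z_j$. For $j=1,\ldots,\nu$ put $$C_j=\frac{1}{(s_j-1)!\,z_j^{s_j-1}\,\bigl(D_j(z_j)\bigr)^2A_j}.$$ The set $\mathcal{N}_{\mathbb{F}}$. Let $\Delta(z)=(z-z_1)\cdots(z-z_\nu)$ and $\Delta_j(z)=\Delta(z)/(z-z_j)$. For $\tau=(\tau_1,\ldots,\tau_\nu)\in\mathbb{F}$ put $$\omega(z,\tau)=\sum_{j=1}^{\nu}C_j\Delta_j(z)\tau_j .$$ $\mathcal{N}_{\mathbb{F}}$ is the set of all $z\in\mathbb{C}$ such that $\omega(z,\tau)=0$ for some $\tau\in\mathbb{F}$.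 It is a closed set. The set $\mathbb{U}_{\mathbb{F}}$. $$\mathbb{U}_{\mathbb{F}}=\mathcal{D}_\rho\setminus\bigl(\mathcal{N}_{\mathbb{F}}\cup\{z_{\mu+1},\ldots,z_\ell\}\bigr),$$ which is an open set. Uniform convergence of $\pi_{n,\lambda-1}$ to $a$ on a compact set $K$ means that for all sufficiently large $n$ the function $\pi_{n,\lambda-1}$ has no poles on $K$ and $\sup_{z\in K}|\pi_{n,\lambda-1}(z)-a(z)|\to 0$ as $n\to\infty$. *)

(* Defs.v *)
(* MathComp-Analysis: complex numbers are R[i] for R : realType. *)
From HB Require Import structures.
From mathcomp Require Import all_boot all_order all_algebra.
From mathcomp Require Import complex.
From mathcomp Require Import all_classical all_reals all_analysis.

Set Implicit Arguments.
Unset Strict Implicit.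
Unset Printing Implicit Defensive.

Import Order.TTheory GRing.Theory Num.Theory.
Import numFieldNormedType.Exports.

Local Open Scope classical_set_scope.
Local Open Scope complex_scope.
Local Open Scope ring_scope.

(* R[i] is normed by its modulus, which takes its values in R[i] itself (they
   are real); this copies the structure that R[i]^o has as a numFieldType. *)
HB.instance Definition _ (R : realType) := NormedModule.copy R[i] R[i]^o.

Definition analytic_at (R : realType) (f : R[i] -> R[i]) (w : R[i]) : Prop :=
  exists c : nat -> R[i],
    \forall z \near w, series (fun k => c k * (z - w) ^+ k) @ \oo --> f z.

(* f z = \sum_(k >= - N) c k * (z - w) ^ k in a punctured neighbourhood of w:
   only Laurent series with finite principal part are considered. *)
Definition laurent_expansion (R : realType) (f : R[i] -> R[i]) (w : R[i])
    (c : int -> R[i]) : Prop :=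
  exists N : nat,
    (forall k : int, k < - N%:Z -> c k = 0) /\
    \forall z \near w^',
      series (fun i : nat => c (i%:Z - N%:Z) * (z - w) ^ (i%:Z - N%:Z)) @ \oo
        --> f z.

(* The Laurent expansion is unique, so that the choice is immaterial; the value
   is 0 if f has no expansion at w. *)
Definition laurent_coef (R : realType) (f : R[i] -> R[i]) (w : R[i]) (k : int) :
    R[i] :=
  xget 0 [set x | exists c, laurent_expansion f w c /\ x = c k].

Definition pole_of_order (R : realType) (f : R[i] -> R[i]) (w : R[i])
    (s : nat) : Prop :=
  (0 < s)%N /\
  exists c, [/\ laurent_expansion f w c,
                c (- s%:Z) != 0 &
                forall k : int, k < - s%:Z -> c k = 0].

(* The values of f at its poles are arbitrary. *)
Definition meromorphic_in_disk (R : realType) (f : R[i] -> R[i]) (r : R) :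
    Prop :=
  forall w : R[i], `|w| < r%:C ->
    analytic_at f w \/ exists s, pole_of_order f w s.

(* Indices start at 0: the poles are z 0, ..., z (l - 1), with multiplicities
   s 0, ..., s (l - 1); z and s are unconstrained from l on. *)
Definition poles_in_disk (R : realType) (f : R[i] -> R[i]) (r : R) (l : nat)
    (z : nat -> R[i]) (s : nat -> nat) : Prop :=
  (forall i j, (i < l)%N -> (j < l)%N -> z i = z j -> i = j) /\
  (forall (w : R[i]) (k : nat),
     (`|w| < r%:C /\ pole_of_order f w k) <->
     exists2 j, (j < l)%N & w = z j /\ k = s j).

Definition max_modulus (R : realType) (z : nat -> R[i]) : R[i] := `|z 0%N|.

Record pole_numbering (R : realType) (l mu nu : nat)
    (z : nat -> R[i]) (s : nat -> nat) : Prop := PoleNumbering {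
  nu_gt0 : (1 <= nu)%N ;
  nu_le_mu : (nu <= mu)%N ;
  mu_le_l : (mu <= l)%N ;
  modulus_max : forall j, (j < mu)%N -> `|z j| = max_modulus z ;
  modulus_lt : forall j, (mu <= j < l)%N -> `|z j| < max_modulus z ;
  modulus_noninc : forall i j, (mu <= i <= j)%N -> (j < l)%N ->
    `|z j| <= `|z i| ;
  mult_max : forall j, (j < nu)%N -> s j = s 0%N ;
  mult_lt : forall j, (nu <= j < mu)%N -> (s j < s 0)%N ;
  mult_noninc : forall i j, (nu <= i <= j)%N -> (j < mu)%N -> (s j <= s i)%N
}.

(* e^{i t} *)
Definition expi (R : realType) (t : R) : R[i] := cos t +i* sin t.

Definition torus (R : realType) (nu : nat) : set 'rV[R[i]]_nu :=
  [set tau | forall j, `|tau 0 j| = 1].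

Definition xi_pow (R : realType) (nu : nat) (Theta : nat -> R) (n : int) :
    'rV[R[i]]_nu :=
  \row_(j < nu) expi (2 * pi * Theta j) ^ n.

Definition groupF (R : realType) (nu : nat) (Theta : nat -> R) :
    set 'rV[R[i]]_nu :=
  @torus R nu `&` closure (range (@xi_pow R nu Theta)).

Definition polyD (R : realType) (l : nat) (z : nat -> R[i]) (s : nat -> nat) :
    {poly R[i]} :=
  \prod_(i < l) ('X - (z i)%:P) ^+ s i.

Definition polyDj (R : realType) (l : nat) (z : nat -> R[i]) (s : nat -> nat)
    (j : nat) : {poly R[i]} :=
  polyD l z s %/ ('X - (z j)%:P) ^+ s j.

Definition constC (R : realType) (a : R[i] -> R[i]) (l : nat)
    (z : nat -> R[i]) (s : nat -> nat) (j : nat) : R[i] :=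
  1 / (((s j).-1)`!%:R * z j ^+ (s j).-1 * (polyDj l z s j).[z j] ^+ 2
       * laurent_coef a (z j) (- (s j)%:Z)).

Definition polyDelta (R : realType) (nu : nat) (z : nat -> R[i]) :
    {poly R[i]} :=
  \prod_(i < nu) ('X - (z i)%:P).

Definition polyDeltaj (R : realType) (nu : nat) (z : nat -> R[i]) (j : nat) :
    {poly R[i]} :=
  polyDelta nu z %/ ('X - (z j)%:P).

Definition omega (R : realType) (a : R[i] -> R[i]) (l nu : nat)
    (z : nat -> R[i]) (s : nat -> nat) (w : R[i]) (tau : 'rV[R[i]]_nu) : R[i] :=
  \sum_(j < nu) constC a l z s j * (polyDeltaj nu z j).[w] * tau 0 j.

Definition setNF (R : realType) (a : R[i] -> R[i]) (l nu : nat)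
    (z : nat -> R[i]) (s : nat -> nat) (Theta : nat -> R) : set R[i] :=
  [set w | exists2 tau : 'rV[R[i]]_nu,
             groupF Theta tau & omega a l z s w tau = 0].

Definition setUF (R : realType) (a : R[i] -> R[i]) (l mu nu : nat)
    (z : nat -> R[i]) (s : nat -> nat) (Theta : nat -> R) : set R[i] :=
  [set w | `|w| < max_modulus z] `\`
  (setNF a l nu z s Theta `|` [set w | exists2 j, (mu <= j < l)%N & w = z j]).

(* P / Q is the Padé approximant of type (n, m) of a at 0. *)
Definition is_pade (R : realType) (a : R[i] -> R[i]) (n m : nat)
    (P Q : {poly R[i]}) : Prop :=
  [/\ (size P <= n.+1)%N, (size Q <= m.+1)%N, Q != 0 &
      (fun w : R[i] => a w * Q.[w] - P.[w])
        =O_ (nbhs (0 : R[i])) (fun w : R[i] => w ^+ (n + m + 1))].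

(* Poles and values of the rational function P / Q are those of its reduced
   form: P and Q may vanish simultaneously. *)
Definition ratfun_pole (R : realType) (P Q : {poly R[i]}) (w : R[i]) : Prop :=
  root (Q %/ gcdp P Q) w.

Definition ratfun_eval (R : realType) (P Q : {poly R[i]}) (w : R[i]) : R[i] :=
  (P %/ gcdp P Q).[w] / (Q %/ gcdp P Q).[w].

(* Main.v *)
(* Let g be D a with its removable singularities removed, D having the poles of a
   as its zeros, and let N = n + lambda.  The Pade condition says that
   g Q_n - D P_n = c_n x^N + R_n, where R_n collects the Taylor terms of g Q_n of
   order greater than N.  As g is regular in a disk larger than D_rho, R_n is
   negligible on D_rho.  Modulo D the term D P_n disappears, so that Q_n, whose
   degree is less than that of D, is the residue of c_n x^N / g modulo D, up to a
   small error.  The jets of x^N at the poles are dominated by those of order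
   s_1 - 1 at the dominant poles, whence
     Q_n(w) / (c_n N^(s_1 - 1) rho^N) = (D / Delta)(w) omega(w, xi^N) + O(1 / n).
   On a compact subset of U_F the right-hand side is bounded away from 0, while
   (g Q_n - D P_n) / (c_n N^(s_1 - 1) rho^N) tends to 0.

   There is no contour integral: the Cauchy estimates for locally analytic
   functions are derived from the maximum modulus principle, by averaging over the
   rotations by the roots of unity before applying the Schwarz lemma. *)
Require Import Defs.
From HB Require Import structures.
From mathcomp Require Import all_boot all_order all_algebra.
From mathcomp Require Import complex.
From mathcomp Require Import all_classical all_reals all_analysis.
From mathcomp Require Import ring lra zify.
Set Implicit Arguments.
Unset Strict Implicit.
Unset Printing Implicit Defensive.
Import Order.TTheory GRing.Theory Num.Theory.
Import numFieldNormedType.Exports.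
Local Open Scope classical_set_scope.
Local Open Scope complex_scope.
Local Open Scope ring_scope.

(** The obstacle is that neither the normalization of Q_n nor the size of c_n is known: c_n could a
    priori vanish, and R_n is bounded only through a norm of Q_n. The residue formula closes the
    circle. It is an exact identity, so it bounds that norm by a constant times the normalizing
    factor |c_n| N^(s_1 - 1) rho^N, plus O(1 / n) times the norm itself. For large n the last term
    is absorbed; this shows that c_n is nonzero and makes every error relative to the normalizing
    factor, which then cancels in a - P_n / Q_n = (g Q_n - D P_n) / (D Q_n). The two degrees enter
    at different places: that of P_n makes D P_n a polynomial of degree at most N, so that a single
    unknown coefficient c_n appears; that of Q_n, one less than the number of poles, makes Q_n its
    own residue modulo D. Analyticity is given by local series without a common radius, whence the
    need for estimates that pass from local expansions to a whole disk. *)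

Local Notation nrm := Normc.normc.

(** * The modulus and the topology of the complex numbers *)

Section ComplexModulus.
Variable R : realType.
Implicit Types (x y : R[i]) (e : R).

Lemma nrmE x : `|x| = (nrm x)%:C.
Proof. by []. Qed.

Lemma nrm_ge0 x : 0 <= nrm x.
Proof. by case: x => u v; exact: sqrtr_ge0. Qed.

Lemma nrm0 : nrm (0 : R[i]) = 0.
Proof. exact: Normc.normc0. Qed.

Lemma nrm1 : nrm (1 : R[i]) = 1.
Proof. exact: Normc.normc1. Qed.

Lemma nrmN x : nrm (- x) = nrm x.
Proof. exact: normcN. Qed.

Lemma nrmBC x y : nrm (x - y) = nrm (y - x).
Proof. by rewrite -nrmN opprB. Qed.

Lemma nrmD x y : nrm (x + y) <= nrm x + nrm y.
Proof. exact: le_normcD. Qed.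

Lemma nrmB x y : nrm (x - y) <= nrm x + nrm y.
Proof. by rewrite (le_trans (nrmD _ _))// nrmN. Qed.

Lemma nrm_le_sub x y : nrm x <= nrm (x - y) + nrm y.
Proof. by rewrite -{1}(subrK y x) nrmD. Qed.

Lemma nrmM x y : nrm (x * y) = nrm x * nrm y.
Proof. exact: Normc.normcM. Qed.

Lemma nrmV x : nrm x^-1 = (nrm x)^-1.
Proof. exact: Normc.normcV. Qed.

Lemma nrmX x n : nrm (x ^+ n) = nrm x ^+ n.
Proof. by elim: n => [|n IH]; rewrite ?nrm1// !exprS nrmM IH. Qed.

Lemma nrm_eq0 x : (nrm x == 0) = (x == 0).
Proof. by apply/eqP/eqP => [/Normc.eq0_normc//|->]; exact: nrm0. Qed.

Lemma nrm_gt0 x : (0 < nrm x) = (x != 0).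
Proof. by rewrite lt_def nrm_eq0 nrm_ge0 andbT. Qed.

Lemma nrm_real e : nrm e%:C = `|e|.
Proof. by rewrite /Normc.normc/= expr0n/= addr0 sqrtr_sqr. Qed.

Lemma nrm_nat n : nrm (n%:R : R[i]) = n%:R.
Proof.
have -> : (n%:R : R[i]) = (n%:R : R)%:C by rewrite rmorph_nat.
by rewrite nrm_real ger0_norm.
Qed.

Lemma nrm_sum (I : Type) (s : seq I) (P : pred I) (F : I -> R[i]) :
  nrm (\sum_(i <- s | P i) F i) <= \sum_(i <- s | P i) nrm (F i).
Proof.
elim/big_rec2: _ => [|i u v _ IH]; first by rewrite nrm0.
by rewrite (le_trans (nrmD _ _))// lerD2l.
Qed.

Lemma nrm_ReIm (u v : R) : nrm (u +i* v) <= `|u| + `|v|.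
Proof.
have -> : u +i* v = u%:C + 'i * v%:C by exact: (complexE (u +i* v)).
rewrite (le_trans (nrmD _ _))// nrmM !nrm_real.
suff -> : nrm ('i : R[i]) = 1 by rewrite mul1r.
by rewrite /Normc.normc/= expr0n/= add0r expr1n sqrtr1.
Qed.

Lemma Re_le_nrm x : `|complex.Re x| <= nrm x.
Proof. by rewrite -lecR; exact: normc_ge_Re. Qed.

Lemma Im_le_nrm x : `|complex.Im x| <= nrm x.
Proof.
case: x => u v /=; rewrite -sqrtr_sqr ler_wsqrtr//.
by rewrite lerDr sqr_ge0.
Qed.

Lemma gt0_complexE x : 0 < x -> 0 < complex.Re x /\ x = (complex.Re x)%:C.
Proof. by case: x => u v; rewrite ltcE /= => /andP[/eqP-> ->]. Qed.

(** Balls of [R[i]] have radii in [R[i]], but a positive element of [R[i]] is real: the radius can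
    be taken in [R], and the estimates below are real inequalities. *)
Lemma near_complexP (w : R[i]) (P : R[i] -> Prop) :
  (\forall z \near w, P z) <->
  exists2 e : R, 0 < e & forall h, nrm h < e -> P (w + h).
Proof.
split.
  move=> /nbhs_ballP[e /= /gt0_complexE[e0 eE] eP].
  exists (complex.Re e) => // h he; apply: eP.
  rewrite -ball_normE /ball_ /= opprD addrA subrr add0r normrN nrmE eE.
  by rewrite ltcR.
move=> [e e0 eP]; apply/nbhs_ballP; exists e%:C => /=; first by rewrite ltcR.
move=> y; rewrite -ball_normE /ball_ /= nrmE ltcR nrmBC => /eP.
by rewrite addrC subrK.
Qed.

Lemma near_punctured_complexP (w : R[i]) (P : R[i] -> Prop) :
  (\forall z \near w^', P z) <->
  exists2 e : R, 0 < e & forall h, h != 0 -> nrm h < e -> P (w + h).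
Proof.
have -> : (\forall z \near w^', P z) <-> (\forall z \near w, z != w -> P z).
  by split.
rewrite near_complexP; split=> -[e e0 eP]; exists e => // h.
  by move=> h0 he; apply: eP => //; rewrite -subr_eq0 addrC addKr.
by move=> he; rewrite -subr_eq0 addrC addKr => h0; exact: eP.
Qed.

Lemma cvg_complexP (u : nat -> R[i]) (x : R[i]) :
  u @ \oo --> x <->
  forall e : R, 0 < e -> exists N, forall n, (N <= n)%N -> nrm (u n - x) < e.
Proof.
split.
  move=> /cvgrPdist_lt ux e e0.
  have /ux[N _ NP] : 0 < e%:C by rewrite ltcR.
  by exists N => n /NP /=; rewrite nrmE ltcR nrmBC.
move=> ux; apply/cvgrPdist_lt => e /gt0_complexE[e0 ->].
have [N NP] := ux _ e0.
by exists N => // n /= /NP; rewrite nrmE ltcR nrmBC.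
Qed.

Lemma continuous_nrm_within (A : set R[i]) (f : R[i] -> R) :
  (forall w, A w -> forall e, 0 < e -> exists2 d, 0 < d &
     forall h, A (w + h) -> nrm h < d -> `|f (w + h) - f w| < e) ->
  {within A, continuous f}.
Proof.
move=> fA; apply/subspace_continuousP => w Aw.
apply/cvgrPdist_lt => e e0.
have [d d0 dP] := fA _ Aw _ e0.
rewrite /within/=; apply/near_complexP; exists d => // h hd Awh.
by rewrite distrC; apply: dP.
Qed.

Lemma nrm_continuous : continuous (fun w : R[i] => nrm w).
Proof.
move=> w; apply/(@cvgrPdist_lt _ _ _ _ (@nbhs_filter _ w)) => e e0.
apply/near_complexP; exists e => // h he.
rewrite (le_lt_trans _ he)// ler_norml; apply/andP; split.
  by rewrite lerBrDl lerBlDr nrmD.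
rewrite lerBlDl (le_trans (nrm_le_sub _ (w + h)))// opprD addrA subrr.
by rewrite add0r nrmN addrC.
Qed.

(** A closed subset of the image of the square [[- T, T] x [- T, T]] under the continuous map
    sending [(u, v)] to [u +i* v]. *)
Lemma compact_disk (T : R) : compact [set w : R[i] | nrm w <= T].
Proof.
pose f (p : R * R) : R[i] := p.1 +i* p.2.
pose B := f @` (`[- T, T] `*` `[- T, T]).
have cB : compact B.
  apply: continuous_compact; last first.
    by apply: compact_setX; exact: segment_compact.
  apply: continuous_subspaceT => -[u v].
  apply/cvgrPdist_lt => e /gt0_complexE[e0 ->].
  have e2 : 0 < complex.Re e / 2 by rewrite divr_gt0.
  exists (ball u (complex.Re e / 2), ball v (complex.Re e / 2)).
    by split; exact: nbhsx_ballx.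
  move=> p [/= pu pv]; rewrite nrmE ltcR.
  suff : nrm ((u - p.1) +i* (v - p.2)) < complex.Re e by [].
  rewrite (le_lt_trans (nrm_ReIm _ _))//.
  have -> : complex.Re e = complex.Re e / 2 + complex.Re e / 2 by field.
  exact: ltrD.
apply: (subclosed_compact _ cB).
  by apply: (closed_comp _ (@closed_le _ _)) => w _; exact: nrm_continuous.
move=> w /= wT; exists (complex.Re w, complex.Im w); last by case: w {wT}.
by split; rewrite /= in_itv /= -ler_norml; [exact: le_trans (Re_le_nrm _) wT|exact: le_trans (Im_le_nrm _) wT].
Qed.

End ComplexModulus.

(** * Power series expansions *)

Section LocalExpansions.
Variable R : realType.
Implicit Types (f g : R[i] -> R[i]) (c d : nat -> R[i]).

(* Remainder form of "c is the sequence of Taylor coefficients of f at 0"; the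
   value f 0 is not constrained. It involves no infinite sum, and passes to
   sums, to products with and quotients by linear factors, and to rotations. *)
Definition expands f c : Prop :=
  exists C e : R, [/\ 0 <= C, 0 < e & forall m h, h != 0 -> nrm h <= e ->
    nrm (f h - \sum_(i < m) c i * h ^+ i) <= C * (nrm h / e) ^+ m].

Lemma expands_eq f g c (e : R) : 0 < e ->
  (forall h, h != 0 -> nrm h <= e -> f h = g h) -> expands f c -> expands g c.
Proof.
move=> e0 fg [C [e1 [C0 e10 fP]]]; exists C, (Num.min e e1).
have m0 : 0 < Num.min e e1 by rewrite lt_min e0.
split => // m h h0; rewrite le_min => /andP[he he1].
rewrite -fg// (le_trans (fP _ _ h0 he1))// ler_wpM2l//.
rewrite lerXn2r ?nnegrE ?divr_ge0 ?nrm_ge0 ?(ltW e10) ?(ltW m0)//.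
by rewrite ler_wpM2l ?nrm_ge0// lef_pV2 ?posrE// ge_min lexx orbT.
Qed.

Lemma expands_shrink f c (e : R) : expands f c -> 0 < e ->
  exists C e1 : R, [/\ 0 <= C, 0 < e1, e1 <= e & forall m h, h != 0 ->
    nrm h <= e1 ->
    nrm (f h - \sum_(i < m) c i * h ^+ i) <= C * (nrm h / e1) ^+ m].
Proof.
move=> [C [e1 [C0 e10 fP]]] e0; exists C, (Num.min e e1).
have m0 : 0 < Num.min e e1 by rewrite lt_min e0.
split => //; first by rewrite ge_min lexx.
move=> m h h0; rewrite le_min => /andP[he he1].
rewrite (le_trans (fP _ _ h0 he1))// ler_wpM2l//.
rewrite lerXn2r ?nnegrE ?divr_ge0 ?nrm_ge0 ?(ltW e10) ?(ltW m0)//.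
by rewrite ler_wpM2l ?nrm_ge0// lef_pV2 ?posrE// ge_min lexx orbT.
Qed.

(** At the point [e] every remainder is at most [C], and [c k * e ^+ k] is the difference of two
    consecutive remainders. *)
Lemma expands_coef_bound f c : expands f c ->
  exists C e : R, [/\ 0 <= C, 0 < e & forall k, nrm (c k) <= C * e^-1 ^+ k].
Proof.
move=> [C [e [C0 e0 fP]]]; exists (2 * C), e; split => //.
  by rewrite mulr_ge0.
move=> k; have eC0 : e%:C != 0 :> R[i] by rewrite -nrm_eq0 nrm_real gtr0_norm ?gt_eqF.
have ne : nrm e%:C = e by rewrite nrm_real gtr0_norm.
have := fP k e%:C eC0; have := fP k.+1 e%:C eC0.
rewrite ne divff ?gt_eqF// !expr1n mulr1 big_ord_recr /=.
move=> /(_ (lexx _)) H1 /(_ (lexx _)) H2.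
have : nrm (c k * e%:C ^+ k) <= C + C.
  set S := \sum_(_ < _) _ in H1 H2.
  rewrite (_ : c k * _ = (f e%:C - S) - (f e%:C - (S + c k * e%:C ^+ k))).
    by rewrite (le_trans (nrmB _ _))// lerD.
  by ring.
rewrite nrmM nrmX ne exprVn -ler_pdivlMr ?exprn_gt0//.
by rewrite (_ : C + C = 2 * C) //; ring.
Qed.

Lemma expands_coef_bound_shrink f c (e : R) : expands f c -> 0 < e ->
  exists C e1 : R, [/\ 0 <= C, 0 < e1, e1 <= e,
    forall k, nrm (c k) <= C * e1^-1 ^+ k &
    forall m h, h != 0 -> nrm h <= e1 ->
      nrm (f h - \sum_(i < m) c i * h ^+ i) <= C * (nrm h / e1) ^+ m].
Proof.
move=> fc e0; have [C [e1 [C0 e10 cP]]] := expands_coef_bound fc.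
have m0 : 0 < Num.min e e1 by rewrite lt_min e0.
have [C' [e2 [C'0 e20]]] := expands_shrink fc m0.
rewrite le_min => /andP[e2e e21] fP.
exists (C + C'), e2; split => // [|k|m h h0 he].
- by rewrite addr_ge0.
- rewrite (le_trans (cP k))// ler_pM ?exprn_ge0 ?invr_ge0 ?(ltW e10)//.
    by rewrite lerDl.
  rewrite lerXn2r ?nnegrE ?invr_ge0 ?(ltW e10) ?(ltW e20)//.
  by rewrite lef_pV2 ?posrE.
- rewrite (le_trans (fP m h h0 he))// ler_wpM2r//.
    by rewrite exprn_ge0// divr_ge0 ?nrm_ge0// ltW.
  by rewrite lerDr.
Qed.

Lemma expands_const (q : R[i]) : expands (fun=> q) (fun i => q *+ (i == 0)%N).
Proof.
exists (nrm q), 1; split => [||[|m] h h0 h1]; rewrite ?nrm_ge0//.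
  by rewrite big_ord0 subr0 expr0 mulr1.
rewrite big_ord_recl big1 => [|i _]; last by rewrite mul0r.
rewrite /= addr0 mulr1 subrr nrm0 mulr_ge0 ?nrm_ge0// exprn_ge0//.
by rewrite divr1 nrm_ge0.
Qed.

Lemma expandsD f g c d : expands f c -> expands g d ->
  expands (fun h => f h + g h) (fun i => c i + d i).
Proof.
move=> [C [e [C0 e0 fP]]] gd.
have [C' [e1 [C'0 e10 e1e gP]]] := expands_shrink gd e0.
exists (C + C'), e1; split => [||m h h0 h1] //; first exact: addr_ge0.
have -> : f h + g h - \sum_(i < m) (c i + d i) * h ^+ i =
    (f h - \sum_(i < m) c i * h ^+ i) + (g h - \sum_(i < m) d i * h ^+ i).
  rewrite (eq_bigr (fun i : 'I_m => c i * h ^+ i + d i * h ^+ i)).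
    by rewrite big_split /=; ring.
  by move=> i _; rewrite mulrDl.
rewrite (le_trans (nrmD _ _))// mulrDl lerD ?gP//.
rewrite (le_trans (fP _ _ h0 (le_trans h1 e1e)))// ler_wpM2l//.
rewrite lerXn2r ?nnegrE ?divr_ge0 ?nrm_ge0 ?(ltW e10) ?(ltW e0)//.
by rewrite ler_wpM2l ?nrm_ge0// lef_pV2 ?posrE.
Qed.

Lemma expandsZ (q : R[i]) f c : expands f c ->
  expands (fun h => q * f h) (fun i => q * c i).
Proof.
move=> [C [e [C0 e0 fP]]]; exists (nrm q * C), e.
split => [||m h h0 he] //; first by rewrite mulr_ge0 ?nrm_ge0.
have -> : q * f h - \sum_(i < m) q * c i * h ^+ i =
          q * (f h - \sum_(i < m) c i * h ^+ i).
  by rewrite mulrBr mulr_sumr; under [in RHS]eq_bigr do rewrite mulrA.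
by rewrite nrmM -mulrA ler_wpM2l ?nrm_ge0 ?fP.
Qed.

Lemma expands_rotate (u : R[i]) f c : nrm u = 1 -> expands f c ->
  expands (fun h => f (u * h)) (fun i => c i * u ^+ i).
Proof.
move=> u1 [C [e [C0 e0 fP]]]; exists C, e; split => // m h h0 he.
have nuh : nrm (u * h) = nrm h by rewrite nrmM u1 mul1r.
have uh0 : u * h != 0 by rewrite -nrm_eq0 nuh nrm_eq0.
have := fP m (u * h) uh0; rewrite nuh => /(_ he).
by under eq_bigr do rewrite exprMn mulrA.
Qed.

Lemma expandsX f c : expands f c ->
  expands (fun h => h * f h) (fun i => if i is k.+1 then c k else 0).
Proof.
move=> [C [e [C0 e0 fP]]]; exists (C * e), e.
split => [||[|m] h h0 he] //; first by rewrite mulr_ge0// ltW.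
  have := fP 0 h h0 he; rewrite !big_ord0 !subr0 !expr0 nrmM !mulr1 => fC.
  by rewrite mulrC ler_pM ?nrm_ge0.
rewrite big_ord_recl /= mul0r add0r.
have -> : h * f h - \sum_(i < m) c i * h ^+ bump 0 i =
          h * (f h - \sum_(i < m) c i * h ^+ i).
  rewrite mulrBr mulr_sumr; congr (_ - _); apply: eq_bigr => i _.
  by rewrite /bump /= add1n exprS; ring.
rewrite nrmM exprS mulrA.
have -> : C * e * (nrm h / e) = nrm h * C by field; rewrite gt_eqF.
by rewrite -(mulrA (nrm h)) ler_wpM2l ?nrm_ge0 ?fP.
Qed.

Lemma expandsXV f c : c 0%N = 0 -> expands f c ->
  expands (fun h => f h / h) (fun i => c i.+1).
Proof.
move=> c0 [C [e [C0 e0 fP]]]; exists (C / e), e.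
split => [||m h h0 he] //; first by rewrite divr_ge0// ltW.
have := fP m.+1 h h0 he.
rewrite big_ord_recl c0 mul0r add0r.
have -> : f h - \sum_(i < m) c (lift ord0 i) * h ^+ lift ord0 i =
          h * (f h / h - \sum_(i < m) c i.+1 * h ^+ i).
  rewrite mulrBr mulrCA divff// mulr1 mulr_sumr; congr (_ - _).
  by apply: eq_bigr => i _; rewrite /= /bump /= add1n exprS; ring.
rewrite nrmM exprS mulrA.
have -> : C * (nrm h / e) = nrm h * (C / e) by ring.
by rewrite -(mulrA (nrm h)) ler_pM2l ?nrm_gt0.
Qed.

Lemma expands_linear_mul (q : R[i]) f c : expands f c ->
  exists2 d, expands (fun h => (h + q) * f h) d & d 0%N = q * c 0%N.
Proof.
move=> fc; have := expandsD (expandsX fc) (expandsZ q fc).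
move=> fd; exists (fun i => (if i is k.+1 then c k else 0) + q * c i).
  by apply: expands_eq fd => [|h _ _]; [exact: ltr01|rewrite -mulrDl].
by rewrite add0r.
Qed.

(* The coefficients of f h / (h + q). *)
Fixpoint divcoef (q : R[i]) c k : R[i] :=
  if k is j.+1 then (c k - divcoef q c j) / q else c 0%N / q.

(** Long division telescopes: a truncated quotient times the divisor leaves a single boundary
    term. *)
Lemma sum_divcoef q c m h : q != 0 ->
  (h + q) * \sum_(i < m.+1) divcoef q c i * h ^+ i =
  \sum_(i < m.+1) c i * h ^+ i + divcoef q c m * h ^+ m.+1.
Proof.
move=> q0; elim: m => [|m IH].
  by rewrite !big_ord_recl !big_ord0 /= !addr0 !expr0 expr1; field.
rewrite big_ord_recr mulrDr IH [in RHS]big_ord_recr /= [h ^+ m.+2]exprS.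
by move: (h ^+ m.+1) (\sum_(i < m.+1) _) => X S; field.
Qed.

Lemma expands_linear_div (q : R[i]) f c : q != 0 -> expands f c ->
  exists2 d, expands (fun h => f h / (h + q)) d & d 0%N = c 0%N / q.
Proof.
move=> q0 fc; have nq0 : 0 < nrm q by rewrite nrm_gt0.
(* The bound [nrm q / 2] on the radius serves twice: it closes the geometric induction on [divcoef],
   and it keeps [h + q] away from 0. *)
have [C [e [C0 e0 eq2 cP fP]]] :=
  expands_coef_bound_shrink fc (divr_gt0 nq0 (ltr0Sn R 1)).
have dP k : nrm (divcoef q c k) <= 2 * C / nrm q * e^-1 ^+ k.
  elim: k => [|k IH] /=.
    rewrite nrmM nrmV expr0 mulr1 ler_wpM2r ?invr_ge0 ?nrm_ge0//.
    have := cP 0%N; rewrite expr0 mulr1; lra.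
  rewrite nrmM nrmV.
  rewrite mulrAC ler_wpM2r ?invr_ge0 ?nrm_ge0//.
  rewrite (le_trans (nrmB _ _))//.
  rewrite (le_trans (lerD (cP k.+1) IH))//.
  have -> : 2 * C * e^-1 ^+ k.+1 = C * e^-1 ^+ k.+1 + C * e^-1 ^+ k.+1 by ring.
  rewrite lerD2l exprS mulrA ler_wpM2r ?exprn_ge0 ?invr_ge0 ?(ltW e0)//.
  rewrite -mulrA [2 * _]mulrCA ler_wpM2l//.
  by rewrite ler_pdivrMr// mulrC ler_pdivlMr// mulrC -ler_pdivlMr.
exists (divcoef q c) => //.
have Dq0 : 0 <= 2 / nrm q by rewrite divr_ge0// nrm_ge0.
exists (2 / nrm q * (C + 2 * C / nrm q * e)), e; split => // [|m h h0 he].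
  by rewrite mulr_ge0// addr_ge0// mulr_ge0 ?(ltW e0)// divr_ge0 ?mulr_ge0 ?nrm_ge0.
have nhq : nrm q / 2 <= nrm (h + q).
  have := nrm_le_sub q (- h); rewrite opprK nrmN addrC [q + h]addrC.
  have := le_trans he eq2; lra.
have hq0 : h + q != 0 by rewrite -nrm_gt0 (lt_le_trans _ nhq)// divr_gt0.
have he0 : 0 <= nrm h / e by rewrite divr_ge0 ?nrm_ge0// ltW.
have hqV : nrm (h + q)^-1 <= 2 / nrm q.
  by rewrite nrmV -[2 / _]invf_div lef_pV2 ?posrE ?divr_gt0 ?nrm_gt0.
have Dh k : nrm (divcoef q c k * h ^+ k.+1) <= 2 * C / nrm q * e * (nrm h / e) ^+ k.+1.
  rewrite nrmM nrmX.
  have -> : 2 * C / nrm q * e * (nrm h / e) ^+ k.+1 =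
      2 * C / nrm q * e^-1 ^+ k * nrm h ^+ k.+1.
    by rewrite !exprS !exprMn !exprVn; field; rewrite expf_neq0 ?gt_eqF.
  by rewrite ler_wpM2r ?exprn_ge0 ?nrm_ge0.
have -> : f h / (h + q) - \sum_(i < m) divcoef q c i * h ^+ i =
   (h + q)^-1 * ((f h - \sum_(i < m) c i * h ^+ i) -
     (if m is k.+1 then divcoef q c k * h ^+ m else 0)).
  case: m => [|m]; first by rewrite !big_ord0 !subr0 mulrC.
  rewrite -addrA -opprD -sum_divcoef//.
  by rewrite mulrBr mulKf// [f h / _]mulrC.
rewrite nrmM -(mulrA (2 / nrm q)) ler_pM ?nrm_ge0// mulrDl.
rewrite (le_trans (nrmB _ _))// lerD ?fP//.
case: m => [|m //]; rewrite nrm0 mulr_ge0 ?exprn_ge0//.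
by rewrite mulr_ge0 ?(ltW e0)// divr_ge0 ?mulr_ge0 ?nrm_ge0.
Qed.

(** If [c k], with [k < n], is the first nonzero coefficient, then
    [nrm (c k) * t ^+ k <= D * t ^+ k.+1] for small real [t], which fails as [t] tends to 0. *)
Lemma expands_bigO0 f c n (B e : R) : expands f c -> 0 < e ->
  (forall h, h != 0 -> nrm h <= e -> nrm (f h) <= B * nrm h ^+ n) ->
  forall i, (i < n)%N -> c i = 0.
Proof.
move=> fc e0 fB.
have m0 : 0 < Num.min e 1 by rewrite lt_min e0 ltr01.
have [C [e1 [C0 e10 + fP]]] := expands_shrink fc m0.
rewrite le_min => /andP[e1e e11].
have B0 : 0 <= B.
  have ee : nrm e%:C = e by rewrite nrm_real gtr0_norm.
  have := fB e%:C; rewrite -nrm_eq0 ee gt_eqF// lexx => /(_ isT isT) H.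
  by have := le_trans (nrm_ge0 _) H; rewrite pmulr_lge0// exprn_gt0.
elim/ltn_ind => k IH kn; apply/eqP/contraT; rewrite -nrm_gt0 => ck0.
pose D := B + C / e1 ^+ k.+1.
have D0 : 0 <= D by rewrite addr_ge0// divr_ge0// exprn_ge0// ltW.
pose t := Num.min e1 (nrm (c k) / (2 * (D + 1))).
have D1 : 0 < 2 * (D + 1) by lra.
have t0 : 0 < t by rewrite lt_min e10 divr_gt0.
have nt : nrm t%:C = t by rewrite nrm_real gtr0_norm.
have tC0 : t%:C != 0 :> R[i] by rewrite -nrm_eq0 nt gt_eqF.
have te : t <= e1 by rewrite ge_min lexx.
have t1 : t <= 1 by rewrite (le_trans te).
have := fP k.+1 t%:C tC0; rewrite nt => /(_ te).
rewrite big_ord_recr /= big1 => [|i _]; last by rewrite IH ?mul0r ?(ltn_trans _ kn).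
rewrite add0r => H1; have := fB t%:C tC0; rewrite nt => /(_ (le_trans te e1e)) H2.
have H3 : nrm (c k) * t ^+ k <= D * t ^+ k.+1.
  rewrite -{1}nt -nrmX -nrmM.
  rewrite (le_trans (nrm_le_sub _ (f t%:C)))// nrmBC mulrDl addrC lerD//.
    rewrite (le_trans H2)// ler_wpM2l//.
    by rewrite ler_wiXn2l // ltW.
  by rewrite (le_trans H1)// expr_div_n mulrA mulrAC.
move: H3; rewrite exprSr mulrA mulrAC ler_pM2r ?exprn_gt0// => H3.
have t2 : t <= nrm (c k) / (2 * (D + 1)) by rewrite ge_min lexx orbT.
move: t2; rewrite ler_pdivlMr// => t2.
by exfalso; nra.
Qed.

Lemma expands_unique f c d : expands f c -> expands f d -> c =1 d.
Proof.
move=> fc fd k.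
have := expandsD fc (expandsZ (-1) fd).
move=> /(@expands_bigO0 _ _ k.+1 0 1) /(_ ltr01) H.
apply/eqP; rewrite -subr_eq0 -mulN1r H// => h _ _.
by rewrite mulN1r subrr nrm0 mul0r.
Qed.

End LocalExpansions.

(** * From convergent power and Laurent series to remainder bounds *)

Section SeriesExpansions.
Variable R : realType.
Implicit Types (f g : R[i] -> R[i]) (c d : nat -> R[i]).

Lemma cvg_series_bounded (u : nat -> R[i]) (x : R[i]) :
  series u @ \oo --> x ->
  exists2 B : R, 0 <= B & forall k, nrm (u k) <= B.
Proof.
move=> /cvg_complexP/(_ 1 ltr01)[N NP].
have S0 : 0 <= \sum_(k < N) nrm (u k) by rewrite sumr_ge0// => *; exact: nrm_ge0.
exists (2 + \sum_(k < N) nrm (u k)) => [|k]; first by rewrite addr_ge0.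
have [kN|Nk] := ltnP k N.
  rewrite (bigD1 (Ordinal kN))//= addrCA lerDl addr_ge0// sumr_ge0// => *.
  exact: nrm_ge0.
have -> : u k = (series u k.+1 - x) - (series u k - x).
  by rewrite opprB addrA subrK /series /= big_nat_recr//= addrC addKr.
rewrite (le_trans (nrmB _ _))// (_ : 2 = 1 + 1)// -[X in X <= _]addr0 lerD//.
by rewrite lerD// ltW// NP// (leq_trans Nk).
Qed.

(** Convergence at the point [e / 2] bounds the terms there; on the disk of radius [e / 4] they are
    then dominated by a geometric series of ratio at most [1 / 2], whose tails give the remainder
    bound. *)
Lemma series_expands f c (e : R) : 0 < e ->
  (forall h, h != 0 -> nrm h < e -> series (fun k => c k * h ^+ k) @ \oo --> f h) ->
  expands f c.
Proof.
move=> e0 fP; have e2 : 0 < e / 2 by rewrite divr_gt0.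
have ne2 : nrm (e / 2)%:C = e / 2 by rewrite nrm_real gtr0_norm.
have [||B B0 BP] := cvg_series_bounded (fP (e / 2)%:C _ _).
- by rewrite -nrm_eq0 ne2 gt_eqF.
- by rewrite ne2; lra.
have e4 : 0 < e / 4 by rewrite divr_gt0.
exists (2 * B), (e / 4); split => // [|m h h0 he]; first by rewrite mulr_ge0.
pose x := nrm h / (e / 2).
have x0 : 0 <= x by rewrite divr_ge0 ?nrm_ge0// ltW.
have x2 : x <= 1 / 2 by rewrite ler_pdivrMr//; lra.
have cx k : nrm (c k * h ^+ k) <= B * x ^+ k.
  have := BP k; rewrite !nrmM !nrmX ne2 -ler_pdivlMr ?exprn_gt0// => H.
  rewrite (le_trans (ler_wpM2r _ H)) ?exprn_ge0 ?nrm_ge0//.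
  by rewrite /x (expr_div_n (nrm h)) mulrAC mulrA.
pose S n := series (fun k => c k * h ^+ k) n.
have SE n : S n = \sum_(i < n) c i * h ^+ i by rewrite /S /series /= big_mkord.
(* The factor [1 - (1 / 2) ^+ j] is that of a partial geometric sum; it makes the induction on [j]
   go through. *)
have Sj j : nrm (S (m + j)%N - S m) <= 2 * B * x ^+ m * (1 - (1 / 2) ^+ j).
  elim: j => [|j IH]; first by rewrite addn0 !subrr nrm0 mulr0.
  have -> : S (m + j.+1)%N - S m =
      (S (m + j)%N - S m) + c (m + j)%N * h ^+ (m + j).
    by rewrite !SE addnS big_ord_recr /=; ring.
  rewrite (le_trans (nrmD _ _))//.
  rewrite (le_trans (lerD IH (cx _)))// exprD.
  have xj : x ^+ j <= (1 / 2) ^+ j by rewrite lerXn2r ?nnegrE.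
  have Bm : 0 <= B * x ^+ m by rewrite mulr_ge0// exprn_ge0.
  rewrite mulrA; have := ler_wpM2l Bm xj.
  rewrite [(1 / 2) ^+ j.+1]exprS.
  move: (B * x ^+ m) (x ^+ j) ((1 / 2) ^+ j) (2 * B * x ^+ m)
    (mulrA 2 B (x ^+ m)) => u v w _ <-; lra.
rewrite -SE; have : nrm (f h - S m) <= 2 * B * x ^+ m.
  apply/ler_addgt0Pr => eps eps0.
  have he' : nrm h < e by lra.
  have /cvg_complexP/(_ _ eps0)[N NP] := fP h h0 he'.
  have -> : f h - S m = (S (m + N)%N - S m) - (S (m + N)%N - f h) by ring.
  rewrite (le_trans (nrmB _ _))// lerD//; last by rewrite ltW// NP// leq_addl.
  rewrite (le_trans (Sj N))// ler_piMr ?gerBl ?exprn_ge0//.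
  by rewrite !mulr_ge0// exprn_ge0.
move=> H; rewrite (le_trans H)//; apply: ler_wpM2l; first exact: mulr_ge0.
rewrite lerXn2r ?nnegrE ?x0 ?divr_ge0 ?nrm_ge0 ?(ltW e0)//.
by rewrite /x ler_wpM2l ?nrm_ge0// lef_pV2 ?posrE//; lra.
Qed.

Lemma laurent_expands_step f (c : int -> R[i]) n : c (- n.+1%:Z) = 0 ->
  expands (fun h => h ^+ n * f h) (fun i => c (i%:Z - n%:Z)) <->
  expands (fun h => h ^+ n.+1 * f h) (fun i => c (i%:Z - n.+1%:Z)).
Proof.
move=> cn; split => H.
  have := expandsX H; congr expands; apply/funext => h; first by rewrite mulrA -exprS.
  by case: h => [|i]; rewrite ?sub0r ?cn//; congr c; lia.
have := expandsXV (_ : (fun i : nat => c (i%:Z - n.+1%:Z)) 0%N = 0) H.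
rewrite sub0r => /(_ cn) {}H.
have -> : (fun i : nat => c (i%:Z - n%:Z)) = (fun i : nat => c (i.+1%:Z - n.+1%:Z)).
  by apply/funext => i; congr c; lia.
by apply: expands_eq H => [|h h0 _]; [exact: ltr01|rewrite exprSr; field].
Qed.

(** The order [N] of the definition and the bound [s] are unrelated; the exponent moves from [N] to
    [s] one unit at a time, downwards when [s <= N] and upwards otherwise. *)
Lemma laurent_expands f w (c : int -> R[i]) (s : nat) : laurent_expansion f w c ->
  (forall k : int, k < - s%:Z -> c k = 0) ->
  expands (fun h => h ^+ s * f (w + h)) (fun i => c (i%:Z - s%:Z)).
Proof.
move=> [N [cN /near_punctured_complexP[e e0 eP]]] cs.
have EN : expands (fun h => h ^+ N * f (w + h)) (fun i => c (i%:Z - N%:Z)).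
  apply: (series_expands e0) => h h0 he; have := eP h h0 he.
  rewrite addrC addKr => /cvg_complexP fh; apply/cvg_complexP => eps eps0.
  have hN : 0 < nrm (h ^+ N) by rewrite nrm_gt0 expf_neq0.
  have [M MP] := fh _ (divr_gt0 eps0 hN); exists M => n /MP.
  rewrite ltr_pdivlMr// -nrmM; congr (nrm _ < _).
  rewrite mulrBl [f _ * _]mulrC /series/= mulr_suml; congr (_ - _).
  apply: eq_bigr => i _; rewrite -mulrA; congr (_ * _).
  by rewrite !exprnP -expfzDr// subrK.
have step n : c (- n.+1%:Z) = 0 -> _ := @laurent_expands_step (fun h => f (w + h)) c n.
have [sN|/ltnW Ns] := leqP s N.
  have : forall k, (s <= k <= N)%N -> expands (fun h => h ^+ k * f (w + h)) (fun i => c (i%:Z - k%:Z)).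
    move=> k /andP[]; elim: {k}(N - k)%N {-2}k (erefl (N - k)%N) => [|j IH] k jE sk kN.
      by have -> : k = N by lia.
    apply/step; first by apply: cs; lia.
    by apply: IH; lia.
  by apply; rewrite leqnn.
rewrite -(subnK Ns); elim: (s - N)%N => [|j IH]; first by rewrite add0n.
by rewrite addSn; apply: (step _ _).1 IH; apply: cN; lia.
Qed.

(** Uniqueness is that of Taylor coefficients, after multiplication by a power of [z - w] that
    clears both principal parts; the exponent [M] also makes [k + M] nonnegative. *)
Lemma laurent_coefE f w (c : int -> R[i]) k : laurent_expansion f w c -> laurent_coef f w k = c k.
Proof.
move=> fc; rewrite /laurent_coef; case: xgetP => [x _ /= [c' [fc' ->]]|H]; last first.
  by have := H (c k) => /= -[]; exists c.
have [[N [cN _]] [N' [cN' _]]] := (fc, fc').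
pose M := (N + N' + `|k|)%N.
have cM (j : int) : j < - M%:Z -> c j = 0 by move=> jM; apply: cN; lia.
have cM' (j : int) : j < - M%:Z -> c' j = 0 by move=> jM; apply: cN'; lia.
have := expands_unique (laurent_expands fc' cM') (laurent_expands fc cM).
by move=> /(_ (absz (k + M%:Z)%R)); congr (c' _ = c _); lia.
Qed.

End SeriesExpansions.

(** * Regular functions *)

Section Regular.
Variable R : realType.
Implicit Types (f g : R[i] -> R[i]) (c d : nat -> R[i]) (w : R[i]).

(** Analyticity in remainder form. The value at [w] is a separate condition because [expands] does
    not see it: a removable singularity with a wrong value is not regular. *)
Definition regular_at f w : Prop :=
  exists2 c, expands (fun h => f (w + h)) c & c 0%N = f w.

Lemma analytic_regular f w : analytic_at f w -> regular_at f w.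
Proof.
move=> [c /near_complexP[e e0 eP]]; exists c.
  apply: (series_expands e0) => h h0 /eP.
  by rewrite addrC addKr.
have := eP 0; rewrite nrm0 addr0 subrr => /(_ e0) fw.
have : series (fun k => c k * 0 ^+ k) @ \oo --> c 0%N.
  apply/cvg_complexP => eps eps0; exists 1%N => -[//|n] _.
  rewrite /series/= big_nat_recl//= big1 => [|i _]; last by rewrite expr0n mulr0.
  by rewrite expr0n mulr1 addr0 subrr nrm0.
by move=> c0; exact: (@cvg_unique _ (@norm_hausdorff _ _) _ _ _ _ c0 fw).
Qed.

Lemma regular_eq f g w (e : R) : 0 < e ->
  (forall h, nrm h <= e -> f (w + h) = g (w + h)) ->
  regular_at f w -> regular_at g w.
Proof.
move=> e0 fg [c fc cw]; exists c; first by apply: (expands_eq e0) fc => h _ /fg.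
by have := fg 0; rewrite addr0 nrm0 ltW// => <-.
Qed.

Lemma regular_const (q : R[i]) w : regular_at (fun=> q) w.
Proof. by exists (fun i => q *+ (i == 0)%N); [exact: expands_const|]. Qed.

Lemma regularD f g w : regular_at f w -> regular_at g w ->
  regular_at (fun z => f z + g z) w.
Proof.
move=> [c fc cw] [d gd dw]; exists (fun i => c i + d i); last by rewrite cw dw.
exact: expandsD fc gd.
Qed.

Lemma regularZ (q : R[i]) f w : regular_at f w -> regular_at (fun z => q * f z) w.
Proof.
move=> [c fc cw]; exists (fun i => q * c i); last by rewrite cw.
exact: expandsZ fc.
Qed.

Lemma regularB f g w : regular_at f w -> regular_at g w ->
  regular_at (fun z => f z - g z) w.
Proof.
move=> fw /(regularZ (-1)) gw; have := regularD fw gw.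
by congr regular_at; apply/funext => z; rewrite mulN1r.
Qed.

Lemma regular_sum (I : Type) (s : seq I) (F : I -> R[i] -> R[i]) w :
  (forall i, regular_at (F i) w) -> regular_at (fun z => \sum_(i <- s) F i z) w.
Proof.
move=> Fw; elim: s => [|i s IH].
  by have := regular_const 0 w; congr regular_at; apply/funext => z; rewrite big_nil.
by have := regularD (Fw i) IH; congr regular_at; apply/funext => z; rewrite big_cons.
Qed.

Lemma regular_linear_mul (p : R[i]) f w : regular_at f w ->
  regular_at (fun z => (z - p) * f z) w.
Proof.
move=> [c fc cw]; have [d fd d0] := expands_linear_mul (w - p) fc.
exists d; last by rewrite d0 cw.
by move: fd; congr expands; apply/funext => h; congr (_ * _); ring.
Qed.

Lemma regular_linear_div (p : R[i]) f w : w != p -> regular_at f w ->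
  regular_at (fun z => f z / (z - p)) w.
Proof.
move=> wp [c fc cw].
have [|d fd d0] := @expands_linear_div _ (w - p) _ _ _ fc; first by rewrite subr_eq0.
exists d; last by rewrite d0 cw.
by move: fd; congr expands; apply/funext => h; congr (_ / _); ring.
Qed.

Lemma regular_polyM (p : {poly R[i]}) f w : regular_at f w ->
  regular_at (fun z => p.[z] * f z) w.
Proof.
elim/poly_ind: p f => [|p q IH] f fw.
  by have := regular_const 0 w; congr regular_at; apply/funext => z; rewrite horner0 mul0r.
have := regularD (IH _ (regular_linear_mul 0 fw)) (regularZ q fw).
by congr regular_at; apply/funext => z; rewrite hornerMXaddC subr0; ring.
Qed.

Lemma regular_poly (p : {poly R[i]}) w : regular_at (fun z => p.[z]) w.
Proof.
have := regular_polyM p (regular_const 1 w).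
by congr regular_at; apply/funext => z; rewrite mulr1.
Qed.

Lemma regular_rotate (u : R[i]) f w : nrm u = 1 -> regular_at f (u * w) ->
  regular_at (fun z => f (u * z)) w.
Proof.
move=> u1 [c fc cw]; exists (fun i => c i * u ^+ i); last by rewrite mulr1.
have := expands_rotate u1 fc.
by congr expands; apply/funext => h; rewrite mulrDr.
Qed.

Lemma regular_translate f w v : regular_at f (v + w) -> regular_at (fun z => f (v + z)) w.
Proof.
move=> [c fc cw]; exists c => //.
by move: fc; congr expands; apply/funext => h; rewrite addrA.
Qed.

Lemma regular_continuous f w (eps : R) : regular_at f w -> 0 < eps ->
  exists2 d, 0 < d & forall h, nrm h < d -> nrm (f (w + h) - f w) < eps.
Proof.
move=> [c [C [e [C0 e0 fP]]] cw] eps0.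
pose d := Num.min e (eps * e / (C + 1)).
have C1 : 0 < C + 1 by rewrite ltr_wpDl.
exists d; first by rewrite lt_min e0 divr_gt0// mulr_gt0.
move=> h; rewrite lt_min => /andP[he hd].
have [->|h0] := eqVneq h 0; first by rewrite addr0 subrr nrm0.
have := fP 1%N h h0 (ltW he); rewrite big_ord1 cw expr0 mulr1 expr1.
move=> /le_lt_trans; apply; rewrite mulrA ltr_pdivrMr//.
move: hd; rewrite ltr_pdivlMr// => hd; apply: le_lt_trans hd.
by rewrite mulrC ler_wpM2l ?nrm_ge0// lerDl.
Qed.

Lemma regular_within_continuous f (A : set R[i]) :
  (forall w, A w -> regular_at f w) ->
  {within A, continuous (fun w => nrm (f w))}.
Proof.
move=> fA; apply: continuous_nrm_within => w Aw e e0.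
have [d d0 dP] := regular_continuous (fA w Aw) e0.
exists d => // h _ hd; apply: le_lt_trans (dP h hd).
rewrite ler_norml; apply/andP; split.
  by rewrite lerNl opprB lerBlDr nrmBC nrm_le_sub.
by rewrite lerBlDr nrm_le_sub.
Qed.

End Regular.

(** * Maximum modulus principle and Cauchy estimates *)

Section MaximumModulus.
Variable R : realType.
Implicit Types (f g : R[i] -> R[i]) (c d : nat -> R[i]) (w : R[i]).

Lemma le0_geometric (x C q : R) : 0 <= q < 1 -> (forall m, x <= C * q ^+ m) -> x <= 0.
Proof.
move=> /andP[q0 q1] H.
have : (fun m => C * q ^+ m) @ \oo --> C * 0.
  by apply: cvgM; [exact: cvg_cst|apply: cvg_expr; rewrite ger0_norm].
rewrite mulr0 => cv; rewrite -(cvg_lim (@Rhausdorff R) cv).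
by apply: limr_ge; [exact: cvgP cv|near=> m; exact: H].
Unshelve. all: by end_near. Qed.

(* The direction v along which a perturbation of b0 increases its modulus. *)
Lemma aligned_root (b0 b1 : R[i]) m : (0 < m)%N -> b1 != 0 ->
  exists2 v, v != 0 & forall t : R, 0 <= t ->
    nrm (b0 + b1 * v ^+ m * t%:C) = nrm b0 + nrm (b1 * v ^+ m) * t.
Proof.
move=> m0 b10; have [->|b00] := eqVneq b0 0.
  exists 1; rewrite ?oner_eq0// => t t0.
  by rewrite add0r nrm0 add0r expr1n mulr1 nrmM nrm_real ger0_norm.
exists (m.-root (b0 / b1)).
  by rewrite rootC_eq0// mulf_neq0// invr_eq0.
move=> t t0; rewrite rootCK// [b1 * _]mulrC divfK// -{1}[b0]mulr1 -mulrDr nrmM.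
have -> : 1 + t%:C = (1 + t)%:C :> R[i] by rewrite rmorphD.
by rewrite nrm_real ger0_norm ?addr_ge0//; ring.
Qed.

(** Either all coefficients of positive index vanish, and the remainders force [f] to be constant
    nearby, or the first nonzero one outweighs the remainder in a direction where it increases the
    modulus. *)
Lemma regular_local_modulus f w : regular_at f w ->
  (exists2 e : R, 0 < e & forall h, nrm h < e -> f (w + h) = f w) \/
  (forall e : R, 0 < e -> exists2 h, nrm h < e & nrm (f w) < nrm (f (w + h))).
Proof.
move=> [c [C [e [C0 e0 fP]]] cw].
have [[m cm]|H] := pselect (exists m, c m.+1 != 0); last first.
  left; exists (e / 2) => [|h hd]; first by rewrite divr_gt0.
  have [->|h0] := eqVneq h 0; first by rewrite addr0.
  apply/eqP; rewrite -subr_eq0 -nrm_eq0 eq_le nrm_ge0 andbT.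
  apply: (@le0_geometric _ C (1 / 2)); first by lra.
  case=> [|m].
    apply: le_trans (_ : nrm (f (w + h) - c 0%N) <= _); first by rewrite cw.
    have := fP 1%N h h0; rewrite big_ord1 expr0 !mulr1 expr1 => /(_ _)/le_trans; apply.
      by lra.
    by rewrite ler_piMr// ler_pdivrMr//; lra.
  have := fP m.+1 h h0; rewrite big_ord_recl big1 => [|i _]; last first.
    by have [->|ci] := eqVneq (c (lift ord0 i)) 0; [rewrite mul0r|case: H; exists i].
  rewrite expr0 mulr1 addr0 cw => /(_ _)/le_trans; apply; first by lra.
  rewrite ler_wpM2l// lerXn2r ?nnegrE ?divr_ge0 ?nrm_ge0 ?(ltW e0)//.
  by rewrite ler_pdivrMr//; lra.
right => eps eps0.
have {cm}exm : exists m, c m.+1 != 0 by exists m.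
have [{}m cm mmin] := ex_minnP exm.
have [v v0 vP] := aligned_root (f w) (ltn0Sn m) cm.
pose b := nrm (c m.+1 * v ^+ m.+1).
have b0 : 0 < b by rewrite nrm_gt0 mulf_neq0// expf_neq0.
pose D := C * (nrm v / e) ^+ m.+2.
have nv : 0 < nrm v by rewrite nrm_gt0.
have D0 : 0 <= D by rewrite mulr_ge0// exprn_ge0// divr_ge0 ?nrm_ge0// ltW.
(* The three bounds on [t] keep the displacement below [eps], keep it within the radius of the
   expansion, and make the remainder [D * t ^+ m.+2] less than the gain [b * t ^+ m.+1]. *)
pose t := Num.min (eps / (2 * nrm v)) (Num.min (e / nrm v) (b / (2 * (D + 1)))).
have D1 : 0 < 2 * (D + 1) by lra.
have t0 : 0 < t.
  by rewrite !lt_min !divr_gt0// mulr_gt0.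
have nt : nrm t%:C = t by rewrite nrm_real gtr0_norm.
have tC0 : t%:C != 0 :> R[i] by rewrite -nrm_eq0 nt gt_eqF.
have t1 : t <= eps / (2 * nrm v) by rewrite ge_min lexx.
have t2 : t <= e / nrm v by rewrite !ge_min lexx orbT.
have t3 : t <= b / (2 * (D + 1)) by rewrite !ge_min lexx !orbT.
exists (t%:C * v).
  move: t1; rewrite nrmM nt ler_pdivlMr ?mulr_gt0// => t1.
  have := mulr_gt0 t0 nv; nra.
have tv0 : t%:C * v != 0 by rewrite mulf_neq0.
have := fP m.+2 _ tv0; rewrite nrmM nt -ler_pdivlMr// => /(_ t2).
have -> : \sum_(i < m.+2) c i * (t%:C * v) ^+ i =
    f w + c m.+1 * (t%:C * v) ^+ m.+1.
  rewrite big_ord_recl expr0 mulr1 cw; congr (_ + _).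
  rewrite big_ord_recr big1 => [|i _]; first exact: add0r.
  rewrite /= /bump add1n.
  have [->|ci] := eqVneq (c i.+1) 0; first by rewrite mul0r.
  by have := mmin _ ci; rewrite leqNgt ltn_ord.
have -> : c m.+1 * (t%:C * v) ^+ m.+1 = c m.+1 * v ^+ m.+1 * (t ^+ m.+1)%:C.
  by rewrite exprMn rmorphXn /=; ring.
move=> fr; have := vP (t ^+ m.+1) (exprn_ge0 _ (ltW t0)).
set S := f w + _ in fr *; move=> SE.
have := nrm_le_sub S (f (w + t%:C * v)); rewrite SE -/b nrmBC => H.
have {}fr : nrm (f (w + t%:C * v) - S) <= D * t * t ^+ m.+1.
  by rewrite (le_trans fr)// /D -[t * _ / e]mulrA [(t * _) ^+ _]exprMn [t ^+ m.+2]exprS; lra.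
have tm0 : 0 < t ^+ m.+1 by rewrite exprn_gt0.
have : D * t < b by move: t3; rewrite ler_pdivlMr//; nra.
rewrite -(ltr_pM2r tm0); lra.
Qed.

Lemma maximum_modulus f (T M : R) : 0 <= T ->
  (forall w, nrm w <= T -> regular_at f w) ->
  (forall w, nrm w = T -> nrm (f w) <= M) ->
  forall w, nrm w <= T -> nrm (f w) <= M.
Proof.
move=> T0 fT fM.
pose D := [set w : R[i] | nrm w <= T].
have D0 : D !=set0 by exists 0; rewrite -(nrm0 R) in T0.
have fcont : {within D, continuous (fun w => nrm (f w))}.
  exact: regular_within_continuous.
have [w0 /set_mem Dw0 w0max] := compact_EVT_max D0 (@compact_disk R T) fcont.
have {}w0max w : nrm w <= T -> nrm (f w) <= nrm (f w0).
  by move=> wT; apply: w0max; exact: mem_set.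
(* Among the maximum points, one of largest modulus cannot be interior. *)
pose A := D `&` [set w | nrm (f w) = nrm (f w0)].
have clA : closed A.
  have cD : closed D by by apply: compact_closed (@compact_disk R T); exact: norm_hausdorff.
  move=> w Aw; have Dw : D w.
    by apply: cD => B /Aw[x [[Dx _] Bx]]; exists x.
  split => //=; apply/eqP; rewrite eq_le w0max//= leNgt; apply/negP => lt.
  have gap : 0 < nrm (f w0) - nrm (f w) by rewrite subr_gt0.
  have [d d0 dP] := regular_continuous (fT w Dw) gap.
  have /Aw[x [[/= _ xE] xw]] : \forall z \near w, nrm (f z) < nrm (f w0).
    apply/near_complexP; exists d => // h /dP; have := nrm_le_sub (f (w + h)) (f w); lra.
  by move: xw; rewrite /= xE ltxx.
have cA : compact A.
  by apply: subclosed_compact clA (@compact_disk R T) _ => w [].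
have [||w1 /set_mem[/= w1T w1E] w1max] := @compact_EVT_max _ _ (fun w : R[i] => nrm w) _ _ cA _.
- by exists w0.
- by apply: continuous_subspaceT; exact: nrm_continuous.
have {}w1max w : nrm w <= T -> nrm (f w) = nrm (f w0) -> nrm w <= nrm w1.
  by move=> wT wE; apply: w1max; exact: mem_set.
move=> w /w0max /le_trans; apply; rewrite -w1E.
have [/fM//|w1T'] := eqVneq (nrm w1) T.
have {}w1T : nrm w1 < T by rewrite lt_def eq_sym w1T'.
exfalso; have [[e e0 eP]|H] := regular_local_modulus (fT w1 (ltW w1T)).
  (* Where [f] is locally constant, a radial step outwards reaches a maximum point of larger
     modulus; at [w1 = 0] any direction will do. *)
  pose d := Num.min (e / 2) (T - nrm w1).
  have d0 : 0 < d by rewrite lt_min divr_gt0//= subr_gt0.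
  have de : d < e by rewrite gt_min; apply/orP; left; lra.
  have dT : d <= T - nrm w1 by rewrite ge_min lexx orbT.
  have [v v1 vE] : exists2 v, nrm v = d & nrm (w1 + v) = nrm w1 + d.
    have [->|w10] := eqVneq w1 0.
      by exists d%:C; rewrite ?add0r ?nrm0 ?add0r nrm_real gtr0_norm.
    have n0 : 0 < nrm w1 by rewrite nrm_gt0.
    have dn : 0 < d / nrm w1 by rewrite divr_gt0.
    exists ((d / nrm w1)%:C * w1).
      by rewrite nrmM nrm_real gtr0_norm// divfK// gt_eqF.
    have -> : w1 + (d / nrm w1)%:C * w1 = (1 + d / nrm w1)%:C * w1.
      by rewrite rmorphD /=; ring.
    by rewrite nrmM nrm_real gtr0_norm ?addr_gt0// mulrDl mul1r divfK// gt_eqF.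
  have := w1max (w1 + v); rewrite eP ?v1// w1E vE.
  by move=> /(_ _ erefl); lra.
have [|h hT] := H (T - nrm w1); first by rewrite subr_gt0.
rewrite w1E ltNge w0max//; have := nrmD w1 h; lra.
Qed.

End MaximumModulus.

(** * Schwarz lemma, Cauchy estimates and Taylor remainders *)

Section CauchyEstimates.
Variable R : realType.
Implicit Types (f g : R[i] -> R[i]) (c d : nat -> R[i]) (w : R[i]).

(** The zeros at 0 are divided out one by one: the quotient, completed at 0 by its Taylor
    coefficient, is at most [M / T] on the circle. The maximum principle is applied only when none
    is left. *)
Lemma schwarz f c n (T M : R) : 0 < T ->
  (forall w, nrm w <= T -> regular_at f w) ->
  (forall w, nrm w = T -> nrm (f w) <= M) ->
  expands f c -> c 0%N = f 0 -> (forall i, (i < n)%N -> c i = 0) ->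
  (forall w, nrm w <= T -> nrm (f w) <= M * (nrm w / T) ^+ n) /\
  nrm (c n) <= M / T ^+ n.
Proof.
move=> T0; elim: n f c M => [|n IH] f c M fT fM fc c0 cn.
  have H := maximum_modulus (ltW T0) fT fM.
  split => [w wT|]; first by rewrite expr0 mulr1 H.
  by rewrite expr0 divr1 c0 H// nrm0 ltW.
have f0 : f 0 = 0 by rewrite -c0 cn.
pose g z := if z == 0 then c 1%N else f z / z.
have gc : expands g (fun i => c i.+1).
  apply: expands_eq ltr01 _ (expandsXV (cn 0%N (ltn0Sn n)) fc) => h h0 _.
  by rewrite /g (negbTE h0).
have fg z : f z = z * g z.
  rewrite /g; have [->|z0] := eqVneq z 0; first by rewrite mul0r.
  by rewrite mulrC divfK.
have [||||gM cM] := IH g (fun i => c i.+1) (M / T) _ _ gc.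
- move=> w wT; have [w0|w0] := eqVneq w 0.
    exists (fun i => c i.+1); last by rewrite /g w0 eqxx.
    by rewrite w0; under [fun _ => _]funext do rewrite add0r.
  have := regular_linear_div w0 (fT w wT).
  apply: (@regular_eq _ _ _ _ (nrm w / 2)).
    by rewrite divr_gt0// nrm_gt0.
  move=> h hw; rewrite subr0 /g ifN// -nrm_gt0.
  have := nrm_le_sub w (- h); rewrite opprK nrmN.
  by have w1 : 0 < nrm w; [rewrite nrm_gt0|lra].
- move=> w wT; rewrite ler_pdivlMr// -wT mulrC -nrmM -fg; exact: fM.
- by rewrite /g eqxx.
- by move=> i ni; apply: cn.
split; last by rewrite exprS invfM mulrA.
move=> w wT; rewrite fg nrmM exprS mulrA.
have -> : M * (nrm w / T) = nrm w * (M / T) by ring.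
by rewrite -(mulrA (nrm w)) ler_wpM2l ?nrm_ge0// gM.
Qed.

Lemma expiD (x y : R) : expi (x + y) = expi x * expi y.
Proof.
rewrite /expi cosD sinD; apply/eqP; rewrite eq_complex /=.
by rewrite eqxx addrC [sin x * _]mulrC [cos x * sin y]mulrC eqxx.
Qed.

Lemma expiX (x : R) n : expi x ^+ n = expi (n%:R * x).
Proof.
elim: n => [|n IH]; first by rewrite mul0r /expi cos0 sin0.
by rewrite exprS IH -expiD -natr1 mulrDl mul1r addrC.
Qed.

Lemma nrm_expi (x : R) : nrm (expi x) = 1.
Proof. by rewrite /Normc.normc/= cos2Dsin2 sqrtr1. Qed.

Lemma unity_root_sum N (m : nat) : (0 < m < N)%N ->
  \sum_(j < N) (expi (2 * pi / N%:R) : R[i]) ^+ (j * m) = 0.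
Proof.
move=> /andP[m0 mN]; pose u : R[i] := expi (2 * pi / N%:R) ^+ m.
have N0 : (N%:R : R) != 0 by rewrite pnatr_eq0 -lt0n (ltn_trans m0).
have u1 : u != 1.
  (* Half the argument of [u]: it lies strictly between 0 and [pi], so that [sin t > 0] and the real
     part of [u] is not 1. *)
  pose t : R := m%:R * pi / N%:R.
  have uE : u = expi (t *+ 2).
    by rewrite /u expiX; congr expi; rewrite /t mulr2n; ring.
  have st : 0 < sin t.
    have Npos : 0 < (N%:R : R) by rewrite ltr0n (ltn_trans m0).
    apply: sin_gt0_pi; apply/andP; split; rewrite /t.
      by rewrite divr_gt0// mulr_gt0 ?pi_gt0// ltr0n.
    by rewrite ltr_pdivrMr// mulrC ltr_pM2l ?pi_gt0// ltr_nat.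
  apply/eqP => uu; have : complex.Re u = 1 by rewrite uu.
  rewrite uE /= cos_mulr2n => H.
  by have := cos2Dsin2 t; nra.
have uN : u ^+ N = 1.
  rewrite -exprM mulnC exprM expiX.
  have -> : N%:R * (2 * pi / N%:R) = 2 * pi :> R by field.
  by rewrite mulr_natl /expi cos2pi sin2pi expr1n.
have := subrX1 u N; rewrite uN subrr => /esym/eqP.
rewrite mulf_eq0 subr_eq0 (negbTE u1) /= => /eqP H.
by rewrite -[RHS]H; apply: eq_bigr => j _; rewrite mulnC exprM.
Qed.

Lemma expands_sum (I : Type) (r : seq I) (F : I -> R[i] -> R[i]) (c : I -> nat -> R[i]) :
  (forall i, expands (F i) (c i)) ->
  expands (fun h => \sum_(i <- r) F i h) (fun k => \sum_(i <- r) c i k).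
Proof.
move=> Fc; elim: r => [|i r IH].
  have := expands_const (0 : R[i]).
  by congr expands; apply/funext => h; rewrite big_nil ?mul0rn.
by have := expandsD (Fc i) IH; congr expands; apply/funext => h; rewrite big_cons.
Qed.

Lemma cauchy_estimate f c (T M : R) : 0 < T ->
  (forall w, nrm w <= T -> regular_at f w) ->
  (forall w, nrm w = T -> nrm (f w) <= M) ->
  expands f c -> c 0%N = f 0 -> forall k, nrm (c k) <= M / T ^+ k.
Proof.
move=> T0 fT fM fc c0 k.
pose u : R[i] := expi (2 * pi / k.+1%:R).
have nu j : nrm (u ^+ j) = 1 by rewrite nrmX nrm_expi expr1n.
(* Without the weight [u ^+ j] the constant term would survive the average; with it, the first
   surviving index is [k]. *)
pose F z := \sum_(j < k.+1) u ^+ j * f (u ^+ j * z).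
pose d i := \sum_(j < k.+1) u ^+ j * (c i * (u ^+ j) ^+ i).
(* The rotation average F kills the coefficients of index less than k, so that
   the Schwarz lemma applies to it. *)
have Fd : expands F d.
  by apply: expands_sum => j; apply: expandsZ; apply: expands_rotate.
have dE i : d i = c i * \sum_(j < k.+1) u ^+ (j * i.+1).
  rewrite mulr_sumr; apply: eq_bigr => j _.
  by rewrite mulnS exprD exprM; ring.
have uk1 : u ^+ k.+1 = 1.
  rewrite expiX (_ : _ * _ = 2 * pi); last by rewrite mulrC divfK// pnatr_eq0.
  by rewrite mulr_natl /expi cos2pi sin2pi.
have dk : d k = c k * k.+1%:R.
  rewrite dE (eq_bigr (fun=> 1)) => [|j _]; last by rewrite mulnC exprM uk1 expr1n.
  by rewrite sumr_const card_ord.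
have [||||_ +] := @schwarz F d k T (k.+1%:R * M) T0 _ _ Fd.
- move=> w wT; apply: regular_sum => j; apply: regularZ.
  by apply: regular_rotate (nu _) _; apply: fT; rewrite nrmM nu mul1r.
- move=> w wT; rewrite (le_trans (nrm_sum _ _ _))//.
  apply: le_trans (_ : \sum_(j < k.+1) M <= _); last first.
    by rewrite sumr_const card_ord mulr_natl.
  by apply: ler_sum => j _; rewrite nrmM nu mul1r fM// nrmM nu mul1r.
- by rewrite /d /F; apply: eq_bigr => j _; rewrite mulr0 expr0 mulr1 c0.
- by move=> i ik; rewrite dE unity_root_sum ?mulr0.
by rewrite dk nrmM nrm_nat mulrC -mulrA ler_pM2l// ltr0Sn.
Qed.

Lemma expands_poly (p : {poly R[i]}) : expands (fun h => p.[h]) (fun i => p`_i).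
Proof.
elim/poly_ind: p => [|p q IH].
  have := expands_const (0 : R[i]).
  by congr expands; apply/funext => h; rewrite ?horner0 ?coef0 ?mul0rn.
have := expandsD (expandsX IH) (expands_const q).
congr expands; apply/funext => h.
  by rewrite hornerMXaddC mulrC.
by rewrite coefD coefMX coefC; case: h => [|h]; rewrite //= ?mulr0n.
Qed.

(** On the circle each of the [n] Taylor terms is at most [M] by the Cauchy estimate, whence the
    factor [n.+1]; the Schwarz lemma carries the bound inside. The linear loss is harmless against
    the geometric factor. *)
Lemma taylor_remainder f c (T M : R) : 0 < T ->
  (forall w, nrm w <= T -> regular_at f w) ->
  (forall w, nrm w = T -> nrm (f w) <= M) ->
  expands f c -> c 0%N = f 0 -> forall n w, nrm w <= T ->
  nrm (f w - (\poly_(i < n) c i).[w]) <= n.+1%:R * M * (nrm w / T) ^+ n.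
Proof.
move=> T0 fT fM fc c0 n w wT.
have cM := cauchy_estimate T0 fT fM fc c0.
pose p := \poly_(i < n) c i.
have [|||||H _] := @schwarz (fun z => f z - p.[z]) (fun i => c i - p`_i) n T (n.+1%:R * M) T0.
- by move=> z zT; apply: regularB; [exact: fT|exact: regular_poly].
- move=> z zT; rewrite (le_trans (nrmB _ _))// -add1n natrD mulrDl mul1r lerD ?fM//.
  rewrite horner_poly (le_trans (nrm_sum _ _ _))//.
  apply: le_trans (_ : \sum_(j < n) M <= _); last first.
    by rewrite sumr_const card_ord mulr_natl.
  apply: ler_sum => i _; rewrite nrmM nrmX zT -ler_pdivlMr ?exprn_gt0//.
- have := expandsD fc (expandsZ (-1) (expands_poly p)).
  by congr expands; apply/funext => h; rewrite mulN1r.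
- by rewrite c0 horner_coef0.
- by move=> i ni; rewrite coef_poly ni subrr.
exact: H.
Qed.

End CauchyEstimates.

(** * Hermite interpolation at the poles *)

Section ClearedFunction.
Variable R : realType.
Implicit Types (a f g : R[i] -> R[i]) (w : R[i]) (l : nat) (z : nat -> R[i]) (s : nat -> nat).

Lemma polyDj_prod l z s (j : 'I_l) :
  polyDj l z s j = \prod_(i < l | i != j) ('X - (z i)%:P) ^+ s i.
Proof.
rewrite /polyDj /polyD (bigD1 j)//= mulKp//.
by rewrite expf_neq0// polyXsubC_eq0.
Qed.

Lemma polyD_factor l z s (j : 'I_l) :
  polyD l z s = ('X - (z j)%:P) ^+ s j * polyDj l z s j.
Proof. by rewrite polyDj_prod /polyD (bigD1 j). Qed.

Lemma polyD_monic l z s : polyD l z s \is monic.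
Proof. by apply: monic_prod => i _; apply: monic_exp; exact: monicXsubC. Qed.

Lemma size_polyD l z s : size (polyD l z s) = (\sum_(i < l) s i).+1.
Proof.
elim: l => [|l IH]; first by rewrite /polyD !big_ord0 size_poly1.
rewrite /polyD !big_ord_recr /= size_Mmonic ?monic_neq0 ?polyD_monic//; last first.
  by apply: monic_exp; exact: monicXsubC.
by rewrite IH size_exp_XsubC addnS addSn.
Qed.

Lemma polyD_neq0 l z s w : (forall j, (j < l)%N -> w != z j) -> (polyD l z s).[w] != 0.
Proof.
move=> wz; rewrite /polyD horner_prod; apply/prodf_neq0 => i _.
by rewrite horner_exp hornerXsubC expf_neq0// subr_eq0 wz.
Qed.

Lemma polyDj_neq0 l z s (j : 'I_l) :
  (forall i j, (i < l)%N -> (j < l)%N -> z i = z j -> i = j) ->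
  (polyDj l z s j).[z j] != 0.
Proof.
move=> zinj; rewrite polyDj_prod horner_prod; apply/prodf_neq0 => i ij.
rewrite horner_exp hornerXsubC expf_neq0// subr_eq0.
by apply: contraNneq ij => /esym/zinj E; apply/eqP/val_inj/E.
Qed.

Lemma separation l z w : exists2 e : R, 0 < e &
  forall j, (j < l)%N -> z j != w -> e < nrm (z j - w).
Proof.
elim: l => [|l [e e0 eP]]; first by exists 1.
have [zw|zw] := eqVneq (z l) w.
  exists e => // j; rewrite ltnS leq_eqVlt => /orP[/eqP->|/eP//].
  by rewrite zw eqxx.
have n0 : 0 < nrm (z l - w) by rewrite nrm_gt0 subr_eq0.
exists (Num.min e (nrm (z l - w) / 2)); first by rewrite lt_min e0 divr_gt0.
move=> j; rewrite ltnS leq_eqVlt gt_min => /orP[/eqP-> _|jl zj].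
  by apply/orP; right; lra.
by rewrite eP.
Qed.

(** A regular function is bounded near [w], so [h ^+ k * a (w + h)] is of order at least one and its
    constant coefficient, which is the leading Laurent coefficient, vanishes. *)
Lemma pole_not_regular a w k : regular_at a w -> ~ pole_of_order a w k.
Proof.
move=> [d [C [e [C0 e0 aP]]] _] [k0 [c [ac ck kc]]].
have := @expands_bigO0 _ _ _ 1 C (Num.min e 1) (laurent_expands ac kc).
rewrite lt_min e0 ltr01 => /(_ isT) H.
move: ck; rewrite -[- _]add0r H ?eqxx// => h h0; rewrite le_min => /andP[he h1].
have := aP 0%N h h0 he; rewrite big_ord0 subr0 expr0 mulr1 => ah.
rewrite nrmM nrmX mulrC ler_pM ?exprn_ge0 ?nrm_ge0//.
by rewrite ler_wiXn2l ?nrm_ge0.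
Qed.

(* g is the product of a and polyD, with its removable singularities removed. *)
Lemma cleared_function a (r : R) l z s :
  meromorphic_in_disk a r -> poles_in_disk a r l z s ->
  exists g, [/\ forall w, nrm w < r -> regular_at g w,
    forall w, (forall j, (j < l)%N -> w != z j) -> g w = (polyD l z s).[w] * a w,
    forall j, (j < l)%N ->
      g (z j) = (polyDj l z s j).[z j] * laurent_coef a (z j) (- (s j)%:Z) &
    forall j, (j < l)%N -> laurent_coef a (z j) (- (s j)%:Z) != 0].
Proof.
move=> am [zinj polesP].
pose g w := if [pick j : 'I_l | z j == w] is Some j then
    (polyDj l z s j).[z j] * laurent_coef a (z j) (- (s j)%:Z)
  else (polyD l z s).[w] * a w.
have gout w : (forall j, (j < l)%N -> w != z j) -> g w = (polyD l z s).[w] * a w.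
  move=> wz; rewrite /g; case: pickP => // j /eqP zj.
  by have := wz j (ltn_ord j); rewrite zj eqxx.
have gin (j : 'I_l) : g (z j) = (polyDj l z s j).[z j] * laurent_coef a (z j) (- (s j)%:Z).
  rewrite /g; case: pickP => [i /eqP zij|/(_ j)]; last by rewrite eqxx.
  by rewrite (val_inj (zinj _ _ (ltn_ord i) (ltn_ord j) zij)).
have poleP (j : 'I_l) : pole_of_order a (z j) (s j).
  by have [_ []] := (polesP (z j) (s j)).2 (ex_intro2 _ _ (val j) (ltn_ord j) (conj erefl erefl)).
exists g; split => // [w wr|j jl|j jl]; last 2 first.
- exact: (gin (Ordinal jl)).
- have [_ [c [ac cj _]]] := poleP (Ordinal jl).
  by rewrite (laurent_coefE _ ac).
have [e e0 eP] := separation l z w.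
have [[j jl zj]|nopole] := pselect (exists2 j, (j < l)%N & z j = w).
  pose o := Ordinal jl; have [_ [c [ac cj cP]]] := poleP o.
  (* Near the pole [g] is [polyDj] times [F], in which the singularity is cancelled by the single
     factor [(x - w) ^+ s j]. *)
  pose F x := if x == w then c (- (s j)%:Z) else (x - w) ^+ s j * a x.
  have Fw : regular_at F w.
    exists (fun i => c (i%:Z - (s j)%:Z)); last by rewrite /F eqxx add0r.
    have ac' : laurent_expansion a w c by rewrite -zj.
    apply: expands_eq ltr01 _ (laurent_expands ac' cP) => h h0 _.
    by rewrite /F -subr_eq0 [w + h]addrC addrK (negbTE h0).
  apply: (regular_eq e0) (regular_polyM (polyDj l z s j) Fw) => h he.
  have [->|h0] := eqVneq h 0.
    by rewrite addr0 -zj (gin o) (laurent_coefE _ ac) /F zj eqxx.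
  rewrite gout /F => [|i il].
    rewrite ifN; last by rewrite -subr_eq0 addrC addKr.
    rewrite (polyD_factor _ _ o) hornerM horner_exp hornerXsubC /= zj.
    by rewrite [w + h]addrC addrK; ring.
  apply/eqP => whz; have := eP i il; rewrite -whz [w + h]addrC addrK.
  by rewrite -subr_eq0 addrK => /(_ h0); rewrite ltNge he.
have wz j : (j < l)%N -> w != z j by move=> jl; apply/eqP => wj; apply: nopole; exists j.
have aw : regular_at a w.
  have [|/analytic_regular//|[k ak]] := am w; first by rewrite nrmE ltcR.
  exfalso; have [|j jl [wj _]] := (polesP w k).1 _; last by apply: nopole; exists j.
  by split => //; rewrite nrmE ltcR.
apply: (regular_eq e0) (regular_polyM (polyD l z s) aw) => h he.
rewrite gout// => j jl; apply/eqP => whz.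
have := eP j jl; rewrite -whz [w + h]addrC addrK -subr_eq0 addrK.
have [h0|h0 /(_ isT)] := eqVneq h 0; last by rewrite ltNge he.
by move: (wz j jl); rewrite -whz h0 addr0 eqxx.
Qed.

End ClearedFunction.

(** * Order of vanishing of functions and divisibility of polynomials *)

Section Vanishing.
Variable R : realType.
Implicit Types (f g : R[i] -> R[i]) (w : R[i]) (p q : {poly R[i]}).

(** Congruence to 0 modulo [('X - w%:P) ^+ n], extended to functions that are not polynomials, such
    as [g]; [vanishes_polyP] leads back to divisibility. *)
Definition vanishes f w (n : nat) : Prop :=
  exists C e : R, [/\ 0 <= C, 0 < e &
    forall h, h != 0 -> nrm h <= e -> nrm (f (w + h)) <= C * nrm h ^+ n].

Lemma vanishesD f g w n : vanishes f w n -> vanishes g w n ->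
  vanishes (fun x => f x + g x) w n.
Proof.
move=> [C [e [C0 e0 fP]]] [C' [e1 [C'0 e10 gP]]]; exists (C + C'), (Num.min e e1).
split; [exact: addr_ge0|by rewrite lt_min e0|move=> h h0].
rewrite le_min => /andP[he he1]; rewrite (le_trans (nrmD _ _))// mulrDl.
by rewrite lerD ?fP ?gP.
Qed.

Lemma vanishesM f g w n : regular_at f w -> vanishes g w n ->
  vanishes (fun x => f x * g x) w n.
Proof.
move=> [c [C [e [C0 e0 fP]]] _] [C' [e1 [C'0 e10 gP]]].
exists (C * C'), (Num.min e e1).
split; [exact: mulr_ge0|by rewrite lt_min e0|move=> h h0].
rewrite le_min => /andP[he he1]; rewrite nrmM -mulrA.
rewrite ler_pM ?nrm_ge0 ?gP//.
by have := fP 0%N h h0 he; rewrite big_ord0 subr0 expr0 mulr1.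
Qed.

Lemma vanishesZ (q : R[i]) f w n : vanishes f w n -> vanishes (fun x => q * f x) w n.
Proof. by apply: vanishesM; exact: regular_const. Qed.

Lemma vanishesB f g w n : vanishes f w n -> vanishes g w n ->
  vanishes (fun x => f x - g x) w n.
Proof.
move=> fw /(vanishesZ (-1)) gw; have := vanishesD fw gw.
by congr vanishes; apply/funext => x; rewrite mulN1r.
Qed.

Lemma expands_vanishes f c w n : expands (fun h => f (w + h)) c ->
  vanishes (fun x => f x - \sum_(k < n) c k * (x - w) ^+ k) w n.
Proof.
move=> [C [e [C0 e0 fP]]]; exists (C / e ^+ n), e; split => // [|h h0 he].
  by rewrite divr_ge0// exprn_ge0// ltW.
have -> : w + h - w = h by rewrite addrC addKr.
rewrite (le_trans (fP n h h0 he))//.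
by rewrite expr_div_n mulrA mulrAC.
Qed.

Lemma vanishes_polyP p w n : vanishes (fun x => p.[x]) w n <-> ('X - w%:P) ^+ n %| p.
Proof.
split; last first.
  move=> /dvdpP[q ->].
  have H : vanishes (fun x => (x - w) ^+ n) w n.
    by exists 1, 1; split => // h _ _; rewrite [w + h]addrC addrK nrmX mul1r.
  have := vanishesM (regular_poly q w) H.
  by congr vanishes; apply/funext => x; rewrite hornerM horner_exp hornerXsubC.
elim: n p => [|n IH] p pw; first by rewrite expr0 dvd1p.
have [c pc cw] := regular_poly p w.
have p0 : p.[w] = 0.
  rewrite -cw; have [C [e [C0 e0 pP]]] := pw.
  exact: (expands_bigO0 pc e0 pP (ltn0Sn n)).
have /factor_theorem[q pE] : root p w by apply/rootP.
rewrite exprSr {1}pE dvdp_mul2r ?polyXsubC_eq0//; apply: IH.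
have [C [e [C0 e0 pP]]] := pw; exists C, e; split => // h h0 he.
have nh : 0 < nrm h by rewrite nrm_gt0.
rewrite -(ler_pM2r nh) -mulrA -exprSr -nrmM.
have := pP h h0 he; rewrite pE hornerM hornerXsubC.
by rewrite [w + h]addrC addrK.
Qed.

End Vanishing.

Section HermiteInterpolation.
Variables (R : realType) (l : nat) (z : nat -> R[i]) (s : nat -> nat).
Hypothesis zinj : forall i j, (i < l)%N -> (j < l)%N -> z i = z j -> i = j.

Local Notation D := (polyD l z s).
Local Notation Dj := (polyDj l z s).

Lemma coprime_polyDj (j : 'I_l) : coprimep (('X - (z j)%:P) ^+ s j) (Dj j).
Proof.
apply: coprimep_expl; rewrite coprimep_sym coprimep_XsubC.
by rewrite /root polyDj_neq0.
Qed.

Lemma polyD_dvdP p : (forall j, (j < l)%N -> ('X - (z j)%:P) ^+ s j %| p) -> D %| p.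
Proof.
rewrite /polyD; suff H k : (k <= l)%N ->
    (forall j, (j < k)%N -> ('X - (z j)%:P) ^+ s j %| p) ->
    \prod_(i < k) ('X - (z i)%:P) ^+ s i %| p by exact: H.
elim: k => [|k IH] kl Hp; first by rewrite big_ord0 dvd1p.
rewrite big_ord_recr /= Gauss_dvdp.
  by rewrite IH ?Hp// ?(ltnW kl)// => j jk; rewrite Hp// ltnS ltnW.
apply: coprimep_expr; rewrite coprimep_XsubC.
rewrite -/(polyD k z s) /root polyD_neq0// => j jk; apply/eqP => zkj.
by have := zinj kl (ltn_trans jk kl) zkj; lia.
Qed.

Lemma crt_idempotents : exists E : nat -> {poly R[i]}, forall j : 'I_l,
  ('X - (z j)%:P) ^+ s j %| E j - 1 /\ Dj j %| E j.
Proof.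
have H (j : 'I_l) : exists p, ('X - (z j)%:P) ^+ s j %| p - 1 /\ Dj j %| p.
  have /Bezout_eq1_coprimepP[[u v] /= uv] := coprime_polyDj j.
  exists (v * Dj j); split; last by rewrite dvdp_mull.
  by rewrite -uv opprD addrCA subrr addr0 dvdpNr dvdp_mull.
exists (fun k => if insub k is Some j then projT1 (cid (H j)) else 0) => j.
by rewrite valK; case: cid.
Qed.

Variable E : nat -> {poly R[i]}.
Hypothesis EP : forall j : 'I_l, ('X - (z j)%:P) ^+ s j %| E j - 1 /\ Dj j %| E j.

Lemma dvdp_sum (I : Type) (r : seq I) (P : pred I) (F : I -> {poly R[i]}) q :
  (forall i, P i -> q %| F i) -> q %| \sum_(i <- r | P i) F i.
Proof.
by move=> H; apply: (big_ind (fun x => q %| x)) => //; exact: dvdp_add.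
Qed.

(* The Hermite interpolant whose Taylor coefficients at z j are b j 0, ...,
   b j (s j).-1, the E j being the idempotents of crt_idempotents. *)
Definition interp (b : nat -> nat -> R[i]) : {poly R[i]} :=
  \sum_(j < l) \sum_(k < s j) b j k *: (E j * ('X - (z j)%:P) ^+ k).

Lemma interp_jet b (j : 'I_l) :
  ('X - (z j)%:P) ^+ s j %| interp b - \sum_(k < s j) b j k *: ('X - (z j)%:P) ^+ k.
Proof.
rewrite /interp (bigD1 j)//= addrAC dvdp_add//.
  rewrite -sumrB; apply: dvdp_sum => k _.
  rewrite -scalerBr -mul_polyC dvdp_mull//.
  have -> Y : E j * Y - Y = (E j - 1) * Y by rewrite mulrBl mul1r.
  by rewrite dvdp_mulr//; have [] := EP j.
apply: dvdp_sum => i ij; apply: dvdp_sum => k _.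
rewrite -mul_polyC dvdp_mull// dvdp_mulr//.
have [_] := EP i; apply: dvdp_trans.
by rewrite polyDj_prod (bigD1 j) 1?eq_sym//= dvdp_mulIl.
Qed.

Lemma XnE (w : R[i]) N m : (m <= N.+1)%N ->
  ('X - w%:P) ^+ m %| 'X^N - \sum_(k < m) ('C(N, k)%:R * w ^+ (N - k)) *: ('X - w%:P) ^+ k.
Proof.
move=> mN; have -> : 'X^N = (w%:P + ('X - w%:P)) ^+ N by rewrite addrC subrK.
rewrite [(_ + _) ^+ N]exprDn.
rewrite -(big_mkord xpredT (fun i => (w%:P ^+ (N - i) * ('X - w%:P) ^+ i) *+ 'C(N, i))).
rewrite (@big_cat_nat _ _ _ m)//= big_mkord addrAC.
rewrite -sumrB big1 ?add0r => [|k _].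
  rewrite big_seq; apply: dvdp_sum => k; rewrite mem_index_iota => /andP[mk _].
  by rewrite -mulr_natr dvdp_mulr// dvdp_mull// dvdp_exp2l.
rewrite -mul_polyC rmorphM rmorphXn /= polyC_natr -mulr_natl; apply/eqP.
by rewrite subr_eq0 mulrA.
Qed.

End HermiteInterpolation.

(** * The denominator as a residue modulo [polyD] *)

Section ResidueRepresentation.
Variables (R : realType) (l : nat) (z : nat -> R[i]) (s : nat -> nat).
Hypothesis zinj : forall i j, (i < l)%N -> (j < l)%N -> z i = z j -> i = j.
Hypothesis s_gt0 : forall j, (j < l)%N -> (0 < s j)%N.

Local Notation D := (polyD l z s).
Local Notation Dj := (polyDj l z s).

Variable E : nat -> {poly R[i]}.
Hypothesis EP : forall j : 'I_l, ('X - (z j)%:P) ^+ s j %| E j - 1 /\ Dj j %| E j.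

Variable g : R[i] -> R[i].
Hypothesis g_reg : forall j, (j < l)%N -> regular_at g (z j).
Hypothesis g_neq0 : forall j, (j < l)%N -> g (z j) != 0.

Lemma interp_vanishes (f : R[i] -> R[i]) (b : nat -> nat -> R[i]) (j : 'I_l) :
  expands (fun h => f (z j + h)) (b j) ->
  vanishes (fun x => (interp l z s E b).[x] - f x) (z j) (s j).
Proof.
move=> fb.
have /vanishes_polyP H := interp_jet EP b j.
have := vanishesB H (expands_vanishes (s j) fb).
congr vanishes; apply/funext => x; rewrite hornerD hornerN.
have -> : (\sum_(k < s j) b j k *: ('X - (z j)%:P) ^+ k).[x] =
    \sum_(k < s j) b j k * (x - z j) ^+ k.
  rewrite horner_sum; apply: eq_bigr => k _.
  by rewrite hornerZ horner_exp hornerXsubC.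
by ring.
Qed.

(** As [g] is not a polynomial, its inverse modulo [D] is taken to be that of its Hermite
    interpolant [U], which is coprime to [D] because no [g (z j)] is 0. *)
Lemma jet_inverse : exists U V : {poly R[i]},
  [/\ forall j : 'I_l, vanishes (fun x => U.[x] - g x) (z j) (s j),
      D %| V * U - 1 &
      forall j : 'I_l, V.[z j] = (g (z j))^-1].
Proof.
have H j : exists c, (j < l)%N -> expands (fun h => g (z j + h)) c /\ c 0%N = g (z j).
  have [jl|_] := boolP (j < l)%N; last by exists (fun=> 0).
  by have [c cP c0] := g_reg jl; exists c.
pose b j := projT1 (cid (H j)).
have bP (j : 'I_l) : expands (fun h => g (z j + h)) (b j) /\ b j 0%N = g (z j).
  by rewrite /b; case: cid => c /= /(_ (ltn_ord j)).
pose U := interp l z s E b.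
have Uz (j : 'I_l) : U.[z j] = g (z j).
  have [_ <-] := bP j; have := interp_jet EP b j.
  have sj := s_gt0 (ltn_ord j).
  move=> /(dvdp_trans (dvdp_exp sj (dvdpp _))).
  rewrite dvdp_XsubCl rootE hornerD hornerN subr_eq0 => /eqP ->.
  rewrite horner_sum (bigD1 (Ordinal sj))//= hornerZ expr0 hornerC mulr1 big1 => [|k k0]; first exact: addr0.
  rewrite hornerZ horner_exp hornerXsubC subrr expr0n.
  rewrite (_ : (k == 0 :> nat)%N = false) ?mulr0//.
  by apply/negP => /eqP k00; move/negP: k0; apply; apply/eqP/val_inj.
have cop : coprimep U D.
  rewrite /polyD coprimep_sym.
  suff H' k : (k <= l)%N -> coprimep (\prod_(i < k) ('X - (z i)%:P) ^+ s i) U by exact: H'.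
  elim: k => [|k IH] kl; first by rewrite big_ord0 coprime1p.
  rewrite big_ord_recr /= coprimepMl IH ?(ltnW kl)//=.
  apply: coprimep_expl; rewrite coprimep_sym coprimep_XsubC rootE.
  by rewrite (Uz (Ordinal kl)) g_neq0.
have [[V W] /= VW] := Bezout_eq1_coprimepP _ _ cop.
exists U, V; split => [j||j].
- by apply: interp_vanishes; have [] := bP j.
- by rewrite -VW opprD addrA subrr add0r dvdpNr dvdp_mull.
- have : (V * U + W * D).[z j] = 1 by rewrite VW hornerC.
  rewrite hornerD !hornerM Uz (polyD_factor _ _ j) hornerM horner_exp hornerXsubC.
  rewrite subrr expr0n eqn0Ngt s_gt0//= mul0r mulr0 addr0 => H1.
  by apply: (mulIf (g_neq0 (ltn_ord j))); rewrite H1 mulVf ?g_neq0.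
Qed.

Variable V : {poly R[i]}.
Hypothesis Vz : forall j : 'I_l, V.[z j] = (g (z j))^-1.

(* V is an inverse of g modulo polyD, so that hermite j k has the jet of
   (x - z j) ^ k / g at z j, and a zero jet at the other poles. *)
Definition hermite (j k : nat) : {poly R[i]} := (V * (E j * ('X - (z j)%:P) ^+ k)) %% D.

Lemma size_hermite j k : (size (hermite j k) <= \sum_(i < l) s i)%N.
Proof. by rewrite -ltnS -(size_polyD l z s) ltn_modp monic_neq0 ?polyD_monic. Qed.

(** At the top order, divisibility by [D] lacks a single factor ['X - (z j)%:P], so that only values
    at [z j] matter. With [g (z j)] equal to D_j(z_j) A_j, this is the origin of the square of
    D_j(z_j) in C_j. *)
Lemma hermite_dominant (j : 'I_l) : hermite j (s j).-1 =
  (((polyDj l z s j).[z j] * g (z j))^-1) *: (('X - (z j)%:P) ^+ (s j).-1 * Dj j).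
Proof.
set k := _^-1; have sj := s_gt0 (ltn_ord j).
have Dz := polyDj_neq0 s j zinj.
suff H : D %| V * (E j * ('X - (z j)%:P) ^+ (s j).-1) -
              k *: (('X - (z j)%:P) ^+ (s j).-1 * Dj j).
  have -> : hermite j (s j).-1 = (k *: (('X - (z j)%:P) ^+ (s j).-1 * Dj j)) %% D.
    by apply/eqP; rewrite -subr_eq0 -modpN -modpD.
  rewrite modp_small// (polyD_factor _ _ j).
  rewrite (leq_ltn_trans (size_scale_leq _ _))//.
  have Dn0 : Dj j != 0 by apply: contraNneq Dz => ->; rewrite horner0.
  rewrite !size_monicM ?monic_exp ?monicXsubC// !size_exp_XsubC.
  by have : (0 < size (Dj j))%N; [rewrite size_poly_gt0|lia].
have [E1 /dvdpP[e Ee]] := EP j.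
have Ez : (E j).[z j] = 1.
  have := dvdp_trans (dvdp_exp sj (dvdpp _)) E1.
  by rewrite dvdp_XsubCl rootE hornerD hornerN hornerC subr_eq0 => /eqP.
rewrite (polyD_factor _ _ j) -{1}(prednK sj) exprSr.
have -> : V * (E j * ('X - (z j)%:P) ^+ (s j).-1) -
    k *: (('X - (z j)%:P) ^+ (s j).-1 * Dj j) =
    ('X - (z j)%:P) ^+ (s j).-1 * (V * e - k%:P) * Dj j.
  by rewrite Ee -mul_polyC; ring.
rewrite dvdp_mul// dvdp_mul// dvdp_XsubCl rootE !hornerE Vz.
have ez : e.[z j] * (Dj j).[z j] = 1 by rewrite -hornerM -Ee.
have gz := g_neq0 (ltn_ord j).
rewrite subr_eq0; apply/eqP; apply: (mulIf Dz); rewrite -mulrA ez /k.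
by field; rewrite Dz gz.
Qed.

Variable U : {poly R[i]}.
Hypothesis U_jet : forall j : 'I_l, vanishes (fun x => U.[x] - g x) (z j) (s j).
Hypothesis VU : D %| V * U - 1.

Lemma residue_representation (Q P : {poly R[i]}) (c : R[i]) (N : nat)
    (f : R[i] -> R[i]) (b : nat -> nat -> R[i]) :
  (size Q <= \sum_(i < l) s i)%N -> (\sum_(i < l) s i <= N)%N ->
  (forall j : 'I_l, expands (fun h => f (z j + h)) (b j)) ->
  (forall x, g x * Q.[x] = D.[x] * P.[x] + c * x ^+ N + f x) ->
  Q = \sum_(j < l) \sum_(k < s j)
        (c * ('C(N, k)%:R * z j ^+ (N - k)) + b j k) *: hermite j k.
Proof.
move=> sQ sN fb gQ.
pose d j k := c * ('C(N, k)%:R * z j ^+ (N - k)) + b j k.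
pose I := interp l z s E d.
have QU : D %| Q * U - I.
  apply: (polyD_dvdP zinj) => j0 jl; pose j := Ordinal jl.
  apply/vanishes_polyP.
  have sjN : (s j <= N.+1)%N.
    by rewrite (leq_trans _ (leqW sN))// (bigD1 j)//= leq_addr.
  have H1 := vanishesM (regular_poly Q (z j)) (U_jet j).
  have H2 : vanishes (fun x => (D * P).[x]) (z j) (s j).
    by apply/vanishes_polyP; rewrite (polyD_factor _ _ j) -mulrA dvdp_mulIl.
  have H3 := expands_vanishes (s j) (fb j).
  have /vanishes_polyP/(vanishesZ c) H4 := XnE (z j) sjN.
  have /vanishes_polyP H5 := interp_jet EP d j.
  (* In this combination the hypothesis on [g * Q] cancels everything but [Q * U - I]: the jets of
     ['X^N] and of [f] together are those prescribed to [I]. *)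
  have := vanishesB (vanishesD (vanishesD (vanishesD H1 H2) H3) H4) H5.
  congr vanishes; apply/funext => x.
  rewrite !hornerD !hornerN !horner_sum hornerXn !hornerM -/I.
  have -> : \sum_(k < s j) (d j k *: ('X - (z j)%:P) ^+ k).[x] =
     c * \sum_(k < s j) (('C(N, k)%:R * z j ^+ (N - k)) *: ('X - (z j)%:P) ^+ k).[x]
     + \sum_(k < s j) b j k * (x - z j) ^+ k.
    rewrite mulr_sumr -big_split /=; apply: eq_bigr => k _.
    by rewrite !hornerZ !horner_exp !hornerXsubC /d /=; ring.
  rewrite mulrBr [Q.[x] * g x]mulrC gQ; ring.
have QVI : D %| Q - V * I.
  have -> : Q - V * I = V * (Q * U - I) - Q * (V * U - 1) by ring.
  by rewrite dvdp_sub// dvdp_mull.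
(* The degree of [Q] is less than that of [D], so [Q] is its own remainder. *)
have VI : Q = (V * I) %% D.
  rewrite -[LHS](@modp_small _ _ D) ?size_polyD ?ltnS//.
  by apply/eqP; rewrite -subr_eq0 -modpN -modpD.
rewrite {1}VI /I /interp mulr_sumr.
have modp_sum (n : nat) (F : 'I_n -> {poly R[i]}) :
    (\sum_(i < n) F i) %% D = \sum_(i < n) (F i %% D).
  by apply: (big_morph (fun p => p %% D)) => [p q|]; [exact: modpD|exact: mod0p].
rewrite modp_sum; apply: eq_bigr => j _; rewrite mulr_sumr modp_sum.
by apply: eq_bigr => k _; rewrite -scalerAr modpZl.
Qed.

End ResidueRepresentation.

(** * Asymptotics of the denominators *)

Section Asymptotics.
Variable R : realType.

Lemma binomial_geometric (q : R) k : 0 <= q < 1 ->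
  exists2 K : R, 0 <= K & forall N, (k < N)%N ->
    'C(N, k)%:R * q ^+ N <= K / (N - k)%:R.
Proof.
move=> /andP[]; rewrite le_eqVlt => /orP[/eqP<- _|q0 q1].
  by exists 0 => // N kN; rewrite expr0n (gtn_eqF (leq_ltn_trans _ kN))// mulr0 mul0r.
pose x := q^-1 - 1; have x0 : 0 < x by rewrite subr_gt0 invf_gt1.
exists (k.+1%:R / x ^+ k.+1) => [|N kN]; first by rewrite divr_ge0// exprn_ge0// ltW.
have Nk : 0 < (N - k)%:R :> R by rewrite ltr0n subn_gt0.
(* Multiplying by [N - k] raises the lower index of the binomial coefficient by one, which costs
   only a constant against a geometric sequence; hence the rate [1 / (N - k)]. *)
have binE : 'C(N, k)%:R * (N - k)%:R = k.+1%:R * 'C(N, k.+1)%:R :> R.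
  by rewrite -!natrM mulnC -mul_bin_left.
have xk0 : 0 < x ^+ k.+1 by rewrite exprn_gt0.
(* One term of the binomial expansion of (1 + x) ^ N. *)
have : 'C(N, k.+1)%:R * x ^+ k.+1 <= q^-1 ^+ N.
  have -> : q^-1 = 1 + x by rewrite /x; ring.
  rewrite [leRHS]exprDn (bigD1 (Ordinal (_ : (k.+1 < N.+1)%N)))//=.
  rewrite expr1n mul1r [leLHS]mulrC mulr_natr lerDl sumr_ge0// => i _.
  by rewrite mulrn_wge0// mulr_ge0 ?exprn_ge0// ltW.
rewrite exprVn -ler_pdivlMr// => H.
rewrite ler_pdivlMr// mulrAC binE -!mulrA ler_pM2l ?ltr0Sn//.
rewrite -ler_pdivlMr ?exprn_gt0// (le_trans H)//.
by rewrite mulrC.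
Qed.

(** The first quantity is the remainder of [polynomial_tail], the second the monomial of order [N].
    Geometric decay is weakened to [1 / N], the rate obtained for the jets at the poles of maximal
    modulus. *)
Lemma linear_geometric (q : R) : 0 <= q < 1 ->
  exists2 K : R, 0 <= K & forall N, (0 < N)%N ->
    N.+2%:R * q ^+ N.+1 <= K / N%:R /\ q ^+ N <= K / N%:R.
Proof.
move=> q01; have [K0 K00 H0] := binomial_geometric 0 q01.
have [K1 K10 H1] := binomial_geometric 1 q01.
exists (K0 + 2 * K1) => [|N N0]; first by rewrite addr_ge0// mulr_ge0.
have NR : 0 < N%:R :> R by rewrite ltr0n.
split.
  apply: le_trans (_ : 2 * K1 / N%:R <= _); last first.
    by rewrite ler_pM2r ?invr_gt0// lerDr.
  have := H1 N.+1 N0; rewrite bin1 subSS subn0 => H.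
  apply: le_trans (_ : 2 * (N.+1%:R * q ^+ N.+1) <= _); last first.
    by rewrite -[leRHS]mulrA ler_pM2l.
  rewrite mulrA ler_wpM2r ?exprn_ge0//; first by case/andP: q01.
  by rewrite -natrM ler_nat; lia.
have := H0 N N0; rewrite bin0 mul1r subn0 => /le_trans; apply.
by rewrite ler_pM2r ?invr_gt0// lerDl mulr_ge0.
Qed.

(* The falling factorial makes the dominant coefficient of the jets of x ^ N
   exactly proportional to (z j / rho) ^ N: see monomial_jet_dominant. *)
Definition scale (m : nat) (rho : R) N : R := (N ^_ m)%:R * rho ^+ N.

Lemma scale_ge m (rho : R) N : 0 < rho -> (m <= N)%N -> rho ^+ N <= scale m rho N.
Proof.
move=> r0 mN; rewrite ler_peMl ?exprn_ge0 ?(ltW r0)//.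
by rewrite ler1n ffact_gt0.
Qed.

Lemma scale_gt0 m (rho : R) N : 0 < rho -> (m <= N)%N -> 0 < scale m rho N.
Proof. by move=> r0 mN; rewrite (lt_le_trans _ (scale_ge r0 mN))// exprn_gt0. Qed.

Lemma leq_ffact N k m : (k <= m <= N)%N -> (N ^_ k <= N ^_ m)%N.
Proof.
move=> /andP[/subnK <-]; elim: (m - k)%N => [//|i IH] iN.
rewrite addSn ffactnSr (leq_trans (IH _)) ?leq_pmulr//; lia.
Qed.

(** A lower order misses at least one factor of the falling factorial:
    [N ^_ k * (N - k) = N ^_ k.+1 <= N ^_ m]. *)
Lemma monomial_jet_equal (w : R[i]) (rho : R) m k : 0 < rho -> nrm w = rho ->
  (k < m)%N -> exists2 K : R, 0 <= K & forall N, (m < N)%N ->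
    nrm ('C(N, k)%:R * w ^+ (N - k)) <= scale m rho N * (K / (N - m)%:R).
Proof.
move=> r0 wr km; exists ((rho ^+ k)^-1) => [|N mN].
  by rewrite invr_ge0 exprn_ge0// ltW.
rewrite nrmM nrm_nat nrmX wr /scale.
have Nm : 0 < (N - m)%:R :> R by rewrite ltr0n subn_gt0.
rewrite mulrA ler_pdivlMr//.
have -> : (N ^_ m)%:R * rho ^+ N * (rho ^+ k)^-1 = (N ^_ m)%:R * rho ^+ (N - k).
  have -> : rho ^+ N = rho ^+ (N - k) * rho ^+ k by rewrite -exprD subnK//; lia.
  by rewrite mulrA mulfK// expf_neq0// gt_eqF.
rewrite mulrAC ler_wpM2r ?exprn_ge0 ?(ltW r0)// -natrM ler_nat.
apply: leq_trans (_ : N ^_ k * (N - k) <= _)%N.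
  apply: leq_mul; last by lia.
  by rewrite -bin_ffact leq_pmulr// fact_gt0.
by rewrite -ffactnSr leq_ffact// km ltnW.
Qed.

(** Inside the circle the decay of [(nrm w / rho) ^+ N] beats the growth of the binomial
    coefficient, whatever the order [k]. *)
Lemma monomial_jet_small (w : R[i]) (rho : R) m k : w != 0 -> nrm w < rho ->
  exists2 K : R, 0 <= K & forall N, (k < N)%N -> (m <= N)%N ->
    nrm ('C(N, k)%:R * w ^+ (N - k)) <= scale m rho N * (K / (N - k)%:R).
Proof.
move=> w0 wr; have nw : 0 < nrm w by rewrite nrm_gt0.
have r0 : 0 < rho by exact: lt_trans wr.
have [|K K0 KP] := @binomial_geometric (nrm w / rho) k.
  by rewrite divr_ge0 ?ltr_pdivrMr ?mul1r ?wr// ltW.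
exists (K / nrm w ^+ k) => [|N kN mN]; first by rewrite divr_ge0// exprn_ge0// ltW.
have -> : nrm ('C(N, k)%:R * w ^+ (N - k)) =
    rho ^+ N * ('C(N, k)%:R * (nrm w / rho) ^+ N / nrm w ^+ k).
  have wE : nrm w ^+ N = nrm w ^+ (N - k) * nrm w ^+ k.
    by rewrite -exprD subnK// ltnW.
  rewrite nrmM nrm_nat nrmX expr_div_n wE.
  by field; rewrite !expf_neq0 ?gt_eqF.
apply: ler_pM; rewrite ?exprn_ge0 ?(ltW r0)//.
- by rewrite divr_ge0 ?mulr_ge0 ?exprn_ge0 ?divr_ge0 ?(ltW r0) ?nrm_ge0.
- exact: scale_ge.
- by rewrite [leRHS]mulrAC ler_pM2r ?invr_gt0 ?exprn_gt0// KP.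
Qed.

Lemma monomial_jet_dominant (w : R[i]) (rho : R) m N : w != 0 -> 0 < rho ->
  (m <= N)%N -> 'C(N, m)%:R * w ^+ (N - m) =
    (scale m rho N)%:C * ((w / rho%:C) ^+ N / (w ^+ m * m`!%:R)) :> R[i].
Proof.
move=> w0 r0 mN.
have rC0 : rho%:C != 0 :> R[i] by rewrite -nrm_eq0 nrm_real gtr0_norm ?gt_eqF.
have m0 : (m`!%:R : R[i]) != 0 by rewrite pnatr_eq0 -lt0n fact_gt0.
rewrite /scale rmorphM rmorphXn rmorph_nat /= -bin_ffact natrM expr_div_n.
have -> : w ^+ N = w ^+ (N - m) * w ^+ m by rewrite -exprD subnK.
by field; rewrite m0 !expf_neq0.
Qed.

End Asymptotics.

(** * Taylor tail of the Padé remainder, and a norm on polynomials *)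

Section PadeTail.
Variable R : realType.

(** Below order [N] the Taylor coefficients of [F] are those of [p], which has none above [N]; the
    Taylor polynomial of degree [N] of [F] is thus [p] plus one monomial. It is applied to [g * Q]
    and [D * P]. *)
Lemma polynomial_tail (F : R[i] -> R[i]) (p : {poly R[i]}) N (T M B e : R) : 0 < T ->
  (forall w, nrm w <= T -> regular_at F w) ->
  (forall w, nrm w = T -> nrm (F w) <= M) ->
  (size p <= N.+1)%N -> 0 < e ->
  (forall h, h != 0 -> nrm h <= e -> nrm (F h - p.[h]) <= B * nrm h ^+ N) ->
  exists c : R[i], forall w, nrm w <= T ->
    nrm (F w - (p.[w] + c * w ^+ N)) <= N.+2%:R * M * (nrm w / T) ^+ N.+1.
Proof.
move=> T0 FT FM sp e0 Fp.
have [|c + c0] := FT 0; first by rewrite nrm0 ltW.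
have -> : (fun h => F (0 + h)) = F by apply/funext => h; rewrite add0r.
move=> Fc; exists (c N - p`_N) => w wT.
have cp i : (i < N)%N -> c i = p`_i.
  have := expandsD Fc (expandsZ (-1) (expands_poly p)).
  move=> /expands_bigO0 /(_ e0) H iN; apply/eqP; rewrite -subr_eq0 -mulN1r.
  apply/eqP; apply: (H N B) => // h h0 he.
  by rewrite mulN1r Fp.
have -> : p.[w] + (c N - p`_N) * w ^+ N = (\poly_(i < N.+1) c i).[w].
  rewrite horner_poly big_ord_recr /= (horner_coef_wide _ sp) big_ord_recr /=.
  rewrite -addrA mulrBl [p`_N * _ + _]addrC subrK; congr (_ + _).
  by apply: eq_bigr => i _; rewrite cp.
exact: taylor_remainder.
Qed.

(** A coefficient norm on polynomials of size at most [n], majorizing the supremum on the disk of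
    radius [T]. *)
Definition pnorm (n : nat) (T : R) (p : {poly R[i]}) : R :=
  \sum_(i < n) nrm p`_i * T ^+ i.

Lemma pnorm_ge0 n (T : R) p : 0 <= T -> 0 <= pnorm n T p.
Proof. by move=> T0; apply: sumr_ge0 => i _; rewrite mulr_ge0 ?nrm_ge0 ?exprn_ge0. Qed.

Lemma pnorm_gt0 n (T : R) (p : {poly R[i]}) : 0 < T -> (size p <= n)%N -> p != 0 -> 0 < pnorm n T p.
Proof.
move=> T0 sp p0; rewrite lt_def pnorm_ge0 ?(ltW T0)// andbT.
apply: contraNneq p0 => /eqP; rewrite psumr_eq0 => [/allP H|i _]; last first.
  by rewrite mulr_ge0 ?nrm_ge0 ?exprn_ge0// ltW.
apply/eqP/polyP => i; rewrite coef0.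
have [ni|ni] := ltnP i n; last by rewrite nth_default// (leq_trans sp).
have /implyP/(_ isT) := H (Ordinal ni) (mem_index_enum _).
by rewrite mulf_eq0 expf_eq0 (gt_eqF T0) andbF orbF nrm_eq0 => /eqP.
Qed.

Lemma horner_le_pnorm n (T : R) (p : {poly R[i]}) w : (size p <= n)%N -> nrm w <= T ->
  nrm p.[w] <= pnorm n T p.
Proof.
move=> sp wT; rewrite (horner_coef_wide _ sp) (le_trans (nrm_sum _ _ _))//.
apply: ler_sum => i _; rewrite nrmM nrmX ler_wpM2l ?nrm_ge0//.
by rewrite lerXn2r ?nnegrE ?nrm_ge0// (le_trans (nrm_ge0 _) wT).
Qed.

Lemma pnorm_sum n (T : R) (I : finType) (F : I -> {poly R[i]}) : 0 <= T ->
  pnorm n T (\sum_i F i) <= \sum_i pnorm n T (F i).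
Proof.
move=> T0; rewrite /pnorm exchange_big /=; apply: ler_sum => i _.
rewrite coef_sum -mulr_suml ler_wpM2r ?exprn_ge0//; exact: nrm_sum.
Qed.

Lemma pnormZ n (T : R) c p : pnorm n T (c *: p) = nrm c * pnorm n T p.
Proof. by rewrite mulr_sumr; apply: eq_bigr => i _; rewrite coefZ nrmM mulrA. Qed.

Lemma regular_bounded (f : R[i] -> R[i]) (T : R) : 0 <= T ->
  (forall w, nrm w <= T -> regular_at f w) ->
  exists2 M : R, 0 <= M & forall w, nrm w <= T -> nrm (f w) <= M.
Proof.
move=> T0 fT; pose D := [set w : R[i] | nrm w <= T].
have fcont : {within D, continuous (fun w => nrm (f w))}.
  exact: regular_within_continuous.
have [|w0 _ w0P] := compact_EVT_max _ (@compact_disk R T) fcont.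
  by exists 0; rewrite -(nrm0 R) in T0.
exists (nrm (f w0)); first exact: nrm_ge0.
by move=> w wT; apply: w0P; exact: mem_set.
Qed.

End PadeTail.

(** * Jets of a monomial at the poles *)

Section DominantJets.
Variables (R : realType) (l mu nu : nat) (z : nat -> R[i]) (s : nat -> nat).
Hypothesis numbering : pole_numbering l mu nu z s.
Hypothesis s_gt0 : forall j, (j < l)%N -> (0 < s j)%N.
Hypothesis z_neq0 : forall j, (j < l)%N -> z j != 0.

Local Notation rho := (nrm (z 0%N)).
Local Notation m := (s 0%N).-1.
Local Notation lambda := (\sum_(i < l) s i)%N.

Lemma l_gt0 : (0 < l)%N.
Proof.
by case: numbering => *; lia.
Qed.

Lemma rho_gt0 : 0 < rho.
Proof. by rewrite nrm_gt0 z_neq0// l_gt0. Qed.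

Lemma modulus_maxE j : (j < mu)%N -> nrm (z j) = rho.
Proof. by move=> /(modulus_max numbering) /complexI. Qed.

Lemma modulus_le_rho j : (j < l)%N -> nrm (z j) <= rho.
Proof.
move=> jl; have [/modulus_maxE->//|muj] := ltnP j mu.
have mujl : (mu <= j < l)%N by rewrite muj.
by have := modulus_lt numbering mujl; rewrite ltcR => /ltW.
Qed.

Lemma s_le_lambda j : (j < l)%N -> (s j <= lambda)%N.
Proof. by move=> jl; rewrite (bigD1 (Ordinal jl))//= leq_addr. Qed.

(** The jet of [x ^+ N] divided by the scale, with the negligible entries replaced by 0. The power
    of [z j / rho] becomes a coordinate of xi^N, and the denominator becomes a factor of that of
    C_j. *)
Definition dominant_jet j k N : R[i] :=
  if (j < nu)%N && (k == m) then (z j / rho%:C) ^+ N / (z j ^+ m * m`!%:R) else 0.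

(** Three cases: the dominant entries are exact, a lower order on the circle of radius [rho] loses a
    factor [n], and poles inside it lose a geometric factor. The shift [lambda] exceeds every order,
    so [N - k] and [N - m] are at least [n]. *)
Lemma jet_asymptotics j k : (j < l)%N -> (k < s j)%N ->
  exists2 K : R, 0 <= K & forall n N, (0 < n)%N -> N = (n + lambda)%N ->
    nrm ('C(N, k)%:R * z j ^+ (N - k) - (scale m rho N)%:C * dominant_jet j k N)
      <= scale m rho N * (K / n%:R).
Proof.
move=> jl ks; have sl := s_le_lambda jl; have s0l := s_le_lambda l_gt0.
have s0 := s_gt0 l_gt0.
have divle (n d : nat) (K : R) : 0 <= K -> (0 < n <= d)%N -> K / d%:R <= K / n%:R.
  move=> K0 /andP[n0 nd]; rewrite ler_wpM2l// lef_pV2 ?posrE ?ltr0n ?ler_nat//; lia.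
have scale0 n : 0 <= scale m rho n by rewrite mulr_ge0 ?exprn_ge0 ?nrm_ge0.
have [jk|jk] := boolP ((j < nu)%N && (k == m)).
  exists 0 => // n N n0 NE; rewrite /dominant_jet jk; move: jk => /andP[jnu /eqP ->].
  rewrite -(monomial_jet_dominant (z_neq0 jl) rho_gt0); last by lia.
  by rewrite subrr nrm0 mul0r mulr0.
have [jmu|muj] := ltnP j mu.
  have km : (k < m)%N.
    have [jnu|nuj] := ltnP j nu.
      have := mult_max numbering jnu; move: jk; rewrite jnu /= => /eqP; lia.
    have nujmu : (nu <= j < mu)%N by rewrite nuj.
    by have := mult_lt numbering nujmu; lia.
  have [K K0 KP] := monomial_jet_equal rho_gt0 (modulus_maxE jmu) km.
  exists K => // n N n0 NE; rewrite /dominant_jet (negbTE jk) mulr0 subr0.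
  apply: le_trans (KP N _) _; first by lia.
  by rewrite ler_wpM2l// divle// n0; lia.
have zr : nrm (z j) < rho.
  have mujl : (mu <= j < l)%N by rewrite muj.
  by have := modulus_lt numbering mujl; rewrite ltcR.
have [K K0 KP] := monomial_jet_small m k (z_neq0 jl) zr.
exists K => // n N n0 NE; rewrite /dominant_jet (negbTE jk) mulr0 subr0.
apply: le_trans (KP N _ _) _; [by lia|by lia|].
by rewrite ler_wpM2l// divle// n0; lia.
Qed.

Lemma dominant_jet_bound j k N : (j < l)%N -> nrm (dominant_jet j k N) <= (rho ^+ m)^-1.
Proof.
move=> jl; rewrite /dominant_jet; case: ifPn => [/andP[jnu _]|_]; last first.
  by rewrite nrm0 invr_ge0 exprn_ge0// nrm_ge0.
have jmu : (j < mu)%N by rewrite (leq_trans jnu)//; case: numbering.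
rewrite nrmM nrmV nrmM !nrmX nrmM nrmV nrm_nat nrm_real (modulus_maxE jmu).
rewrite ger0_norm ?nrm_ge0// divff ?gt_eqF ?rho_gt0// expr1n mul1r.
rewrite lef_pV2 ?posrE ?mulr_gt0 ?exprn_gt0 ?rho_gt0 ?ltr0n ?fact_gt0//.
by rewrite ler_peMr ?exprn_ge0 ?nrm_ge0// ler1n fact_gt0.
Qed.

End DominantJets.

(** * Denominators up to a relative error of order 1 / n *)

Section DenominatorAsymptotics.
Variables (R : realType) (l mu nu : nat) (z : nat -> R[i]) (s : nat -> nat).
Hypothesis numbering : pole_numbering l mu nu z s.
Hypothesis zinj : forall i j, (i < l)%N -> (j < l)%N -> z i = z j -> i = j.
Hypothesis s_gt0 : forall j, (j < l)%N -> (0 < s j)%N.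
Hypothesis z_neq0 : forall j, (j < l)%N -> z j != 0.

Local Notation rho := (nrm (z 0%N)).
Local Notation m := (s 0%N).-1.
Local Notation lambda := (\sum_(i < l) s i)%N.
Local Notation D := (polyD l z s).
Local Notation S := (scale m rho).

Variable T : R.
Hypothesis rhoT : rho < T.
Variable g : R[i] -> R[i].
Hypothesis g_reg : forall w, nrm w <= T -> regular_at g w.
Hypothesis g_neq0 : forall j, (j < l)%N -> g (z j) != 0.

Variable E : nat -> {poly R[i]}.
Hypothesis EP : forall j : 'I_l,
  ('X - (z j)%:P) ^+ s j %| E j - 1 /\ polyDj l z s j %| E j.
Variables U V : {poly R[i]}.
Hypothesis U_jet : forall j : 'I_l, vanishes (fun x => U.[x] - g x) (z j) (s j).
Hypothesis VU : D %| V * U - 1.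

Local Notation hm := (hermite l z s E V).
Local Notation Hn j k := (pnorm lambda T (hm j k)).

Lemma T_gt0 : 0 < T.
Proof. exact: lt_trans (rho_gt0 numbering z_neq0) rhoT. Qed.

Lemma sum_jets_le (a b : nat -> nat -> R[i]) (p q : nat -> nat -> R) :
  (forall j k, (j < l)%N -> (k < s j)%N -> nrm (a j k) <= p j k) ->
  (forall j k, (j < l)%N -> (k < s j)%N -> nrm (b j k) <= q j k) ->
  \sum_(j < l) \sum_(k < s j) nrm (a j k + b j k) * Hn j k <=
  \sum_(j < l) \sum_(k < s j) p j k * Hn j k +
  \sum_(j < l) \sum_(k < s j) q j k * Hn j k.
Proof.
move=> ap bq; rewrite -big_split; apply: ler_sum => j _.
rewrite -big_split; apply: ler_sum => k _ /=.
rewrite -mulrDl ler_wpM2r ?pnorm_ge0 ?(ltW T_gt0)//.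
by rewrite (le_trans (nrmD _ _))// lerD ?ap ?bq.
Qed.

Lemma sum_hermite_horner (d : nat -> nat -> R[i]) w : nrm w <= T ->
  nrm (\sum_(j < l) \sum_(k < s j) d j k * (hm j k).[w]) <=
  \sum_(j < l) \sum_(k < s j) nrm (d j k) * Hn j k.
Proof.
move=> wT; rewrite (le_trans (nrm_sum _ _ _))//; apply: ler_sum => j _.
rewrite (le_trans (nrm_sum _ _ _))//; apply: ler_sum => k _.
by rewrite nrmM ler_wpM2l ?nrm_ge0// horner_le_pnorm// size_hermite.
Qed.

(* K1 and K2 do not depend on n, P and Q; c is the coefficient of order N of
   g Q - D P at 0. *)
Lemma denominator_asymptotics : exists2 K1 : R, 0 <= K1 & exists n0 : nat,
  forall rho' : R, 0 <= rho' < rho -> exists2 K2 : R, 0 <= K2 &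
  forall n N (P Q : {poly R[i]}) (B e : R),
    (n0 <= n)%N -> (0 < n)%N -> N = (n + lambda)%N ->
    (size P <= n.+1)%N -> (size Q <= lambda)%N -> Q != 0 -> 0 < e ->
    (forall h, h != 0 -> nrm h <= e ->
      nrm (g h * Q.[h] - D.[h] * P.[h]) <= B * nrm h ^+ N) ->
  exists c : R[i], [/\ c != 0,
    forall w, nrm w <= T -> nrm (Q.[w] - c * (S N)%:C *
        \sum_(j < l) \sum_(k < s j) dominant_jet nu z s j k N * (hm j k).[w])
      <= nrm c * S N * (K1 / n%:R) &
    forall w, nrm w <= rho' ->
      nrm (g w * Q.[w] - D.[w] * P.[w]) <= nrm c * S N * (K2 / n%:R)].
Proof.
have T0 := T_gt0; have rho0 := rho_gt0 numbering z_neq0.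
have [M M0 gM] := regular_bounded (ltW T0) g_reg.
(* Choice requires a constant for every pair; outside the range of the jets it is 0. *)
have /choice[K' K'P] : forall jk : nat * nat, exists K : R, 0 <= K /\
    ((jk.1 < l)%N -> (jk.2 < s jk.1)%N ->
     forall n N, (0 < n)%N -> N = (n + lambda)%N ->
     nrm ('C(N, jk.2)%:R * z jk.1 ^+ (N - jk.2) -
       (S N)%:C * dominant_jet nu z s jk.1 jk.2 N) <= S N * (K / n%:R)).
  move=> [j k] /=; have [jl|_] := boolP (j < l)%N; last by exists 0.
  have [ks|_] := boolP (k < s j)%N; last by exists 0.
  by have [K K0 KP] := jet_asymptotics numbering s_gt0 z_neq0 jl ks; exists K.
pose K j k := K' (j, k).
have K0 j k : 0 <= K j k by have [] := K'P (j, k).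
have KP j k : (j < l)%N -> (k < s j)%N -> forall n N, (0 < n)%N -> N = (n + lambda)%N ->
     nrm ('C(N, k)%:R * z j ^+ (N - k) -
       (S N)%:C * dominant_jet nu z s j k N) <= S N * (K j k / n%:R).
  by have [] := K'P (j, k).
(* As [rho + eta = T1], the disks of radius [eta] about the poles lie in that of radius [T1 < T], on
   which the tail is already small. *)
pose T1 := (rho + T) / 2; pose eta := (T - rho) / 2.
have eta0 : 0 < eta by rewrite divr_gt0// subr_gt0.
have T10 : 0 <= T1 by rewrite divr_ge0// addr_ge0 ?ltW.
have T1T : T1 < T by have := rhoT; rewrite /T1; lra.
have theta1 : 0 <= T1 / T < 1 by rewrite divr_ge0 ?(ltW T0)//= ltr_pdivrMr// mul1r.
have [Kt Kt0 KtP] := linear_geometric theta1.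
have Hn0 j k : 0 <= Hn j k by rewrite pnorm_ge0// ltW.
(* [A1] majorizes the jets of [x ^+ N] relative to [S N], [A2] those of the tail through the Cauchy
   estimates, and [A3] the errors of [jet_asymptotics], each weighted by the norms of the
   [hm j k]. *)
pose A1 := \sum_(j < l) \sum_(k < s j) ((rho ^+ m)^-1 + K j k) * Hn j k.
pose A2 := \sum_(j < l) \sum_(k < s j) (eta ^+ k)^-1 * Hn j k.
pose A3 := \sum_(j < l) \sum_(k < s j) K j k * Hn j k.
have A10 : 0 <= A1.
  apply: sumr_ge0 => j _; apply: sumr_ge0 => k _.
  by rewrite mulr_ge0// addr_ge0// invr_ge0 exprn_ge0// ltW.
have A20 : 0 <= A2.
  apply: sumr_ge0 => j _; apply: sumr_ge0 => k _.
  by rewrite mulr_ge0// invr_ge0 exprn_ge0// ltW.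
have A30 : 0 <= A3.
  by apply: sumr_ge0 => j _; apply: sumr_ge0 => k _; rewrite mulr_ge0.
pose G := M * Kt * A2; have G0 : 0 <= G by rewrite !mulr_ge0.
(* [A3] is the error on the jets of the monomial; [2 * A1 * G] is that of the tail, once the norm of
   [Q] is replaced by [2 * (nrm c * S N * A1)]. From the bound of [2 * G] on, [G / n] is at most one
   half. *)
exists (A3 + 2 * A1 * G); first by rewrite addr_ge0// !mulr_ge0.
exists (Num.bound (2 * G)) => rho' /andP[rho'0 rho'rho].
have [Ka Ka0 KaP] : exists2 K : R, 0 <= K & forall N, (0 < N)%N ->
    N.+2%:R * (rho' / rho) ^+ N.+1 <= K / N%:R /\ (rho' / rho) ^+ N <= K / N%:R.
  apply: linear_geometric.
  by rewrite divr_ge0 ?(ltW rho0)//= ltr_pdivrMr// mul1r.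
have [Kb Kb0 KbP] : exists2 K : R, 0 <= K & forall N, (0 < N)%N ->
    N.+2%:R * (rho' / T) ^+ N.+1 <= K / N%:R /\ (rho' / T) ^+ N <= K / N%:R.
  apply: linear_geometric.
  by rewrite divr_ge0 ?(ltW T0)//= ltr_pdivrMr// mul1r (lt_trans rho'rho).
exists (Ka + 2 * A1 * (M * Kb)); first by rewrite addr_ge0// !mulr_ge0.
move=> n N P Q B e n0n n0 NE sP sQ Q0 e0 gQP.
have nR : 0 < n%:R :> R by rewrite ltr0n.
have nN : (n <= N)%N by rewrite NE leq_addr.
have N0 : (0 < N)%N by exact: leq_trans nN.
have mN : (m <= N)%N.
  rewrite NE (leq_trans (leq_pred _))// (leq_trans _ (leq_addl _ _))//.
  exact: s_le_lambda (l_gt0 numbering).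
have divN (x : R) : 0 <= x -> x / N%:R <= x / n%:R.
  by move=> x0; rewrite ler_wpM2l// lef_pV2 ?posrE ?ltr0n ?ler_nat.
have S0 : 0 < S N by exact: scale_gt0.
(* As [Q] is not normalized, [L] is the provisional unit of measure, to be traded for
   [nrm c * S N]. *)
pose L := pnorm lambda T Q; have L0 : 0 < L by exact: pnorm_gt0.
have ML0 : 0 <= M * L by rewrite mulr_ge0// ltW.
pose F x := g x * Q.[x].
have F_reg w : nrm w <= T -> regular_at F w.
  move=> /g_reg/(regular_polyM Q); congr regular_at.
  by apply/funext => x; rewrite mulrC.
have FM w : nrm w = T -> nrm (F w) <= M * L.
  move=> wT; rewrite nrmM ler_pM ?nrm_ge0// ?gM ?wT//.
  by apply: horner_le_pnorm; rewrite ?wT.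
have sDP : (size (D * P)%R <= N.+1)%N.
  by rewrite (leq_trans (size_polyMleq _ _))// size_polyD addSn /= NE addnC -addSn leq_add2r.
have [|c cP] := polynomial_tail T0 F_reg FM sDP e0 (B := B).
  by move=> h h0 he; rewrite hornerM gQP.
pose f x := F x - ((D * P).[x] + c * x ^+ N).
have f_reg w : nrm w <= T -> regular_at f w.
  move=> wT; apply: regularB; first exact: F_reg.
  have := regular_poly (D * P + c *: 'X^N) w; congr regular_at.
  by apply/funext => x; rewrite hornerD hornerZ hornerXn.
have tail (q Kq w : R) : 0 <= w <= q -> q <= T ->
    N.+2%:R * (q / T) ^+ N.+1 <= Kq / N%:R -> 0 <= Kq ->
    N.+2%:R * (M * L) * (w / T) ^+ N.+1 <= M * L * (Kq / n%:R).
  move=> /andP[w0 wq] qT qK Kq0; rewrite mulrAC mulrC ler_wpM2l//.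
  apply: le_trans (le_trans qK (divN _ Kq0)); rewrite ler_wpM2l//.
  rewrite lerXn2r ?nnegrE ?divr_ge0 ?(ltW T0)//; first exact: le_trans wq.
  by rewrite ler_pM2r ?invr_gt0.
pose M1 := M * L * (Kt / n%:R).
have M10 : 0 <= M1 by rewrite mulr_ge0// divr_ge0// ltW.
have fM1 w : nrm w <= T1 -> nrm (f w) <= M1.
  move=> wT1; apply: le_trans (cP w (le_trans wT1 (ltW T1T))) _.
  apply: (tail T1); rewrite ?nrm_ge0//; first exact: ltW.
  by have [] := KtP N N0.
have /choice[b bP] : forall j, exists b, (j < l)%N ->
    expands (fun h => f (z j + h)) b /\ forall k, nrm (b k) <= M1 / eta ^+ k.
  move=> j; have [jl|_] := boolP (j < l)%N; last by exists (fun=> 0).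
  have jrho := modulus_le_rho numbering jl.
  have near_zj h : nrm h <= eta -> nrm (z j + h) <= T1.
    by move=> he; rewrite (le_trans (nrmD _ _))// /T1; rewrite /eta in he; lra.
  have [|b fb b0] := f_reg (z j); first by rewrite (le_trans jrho)// ltW.
  exists b => _; split => //.
  apply: (@cauchy_estimate _ (fun h => f (z j + h)) _ eta M1 eta0) fb _ => [h he|h he|].
  - by apply: regular_translate; apply: f_reg; rewrite (le_trans (near_zj _ he))// ltW.
  - by apply: fM1; apply: near_zj; rewrite he.
  - by rewrite addr0.
have g_reg_z j : (j < l)%N -> regular_at g (z j).
  by move=> jl; apply: g_reg; rewrite (le_trans (modulus_le_rho numbering jl))// ltW.
have QE : Q = \sum_(j < l) \sum_(k < s j)
        (c * ('C(N, k)%:R * z j ^+ (N - k)) + b j k) *: hm j k.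
  apply: (residue_representation zinj EP U_jet VU (f := f) (P := P)) => //.
  - by rewrite NE leq_addl.
  - by move=> j; have [] := bP j (ltn_ord j).
  - by move=> x; rewrite /f /F hornerM; ring.
have A2E : \sum_(j < l) \sum_(k < s j) M1 / eta ^+ k * Hn j k = M1 * A2.
  rewrite mulr_sumr; apply: eq_bigr => j _; rewrite mulr_sumr.
  by apply: eq_bigr => k _; rewrite mulrA.
have bM j k : (j < l)%N -> (k < s j)%N -> nrm (b j k) <= M1 / eta ^+ k.
  by move=> jl _; have [_] := bP j jl.
have cS0 : 0 <= nrm c * S N by rewrite mulr_ge0 ?nrm_ge0// ltW.
(* The bound is circular, since [M1] is proportional to [L]; it is solved for [L] below. *)
have L_le : L <= nrm c * S N * A1 + M1 * A2.
  rewrite /L {1}QE (le_trans (pnorm_sum _ _ (ltW T0)))//.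
  apply: le_trans (_ : \sum_(j < l) \sum_(k < s j)
      nrm (c * ('C(N, k)%:R * z j ^+ (N - k)) + b j k) * Hn j k <= _).
    apply: ler_sum => j _; rewrite (le_trans (pnorm_sum _ _ (ltW T0)))//.
    by apply: ler_sum => k _; rewrite pnormZ.
  have cM j k : (j < l)%N -> (k < s j)%N ->
      nrm (c * ('C(N, k)%:R * z j ^+ (N - k))) <= nrm c * S N * ((rho ^+ m)^-1 + K j k).
    move=> jl ks; rewrite nrmM -mulrA ler_wpM2l ?nrm_ge0//.
    rewrite (le_trans (nrm_le_sub _ ((S N)%:C * dominant_jet nu z s j k N)))//.
    rewrite mulrDr addrC lerD//.
      rewrite nrmM nrm_real gtr0_norm// ler_wpM2l ?(ltW S0)//.
      exact: dominant_jet_bound numbering z_neq0 _ _ _ jl.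
    rewrite (le_trans (KP j k jl ks n N n0 NE))// ler_wpM2l ?(ltW S0)//.
    by rewrite ler_pdivrMr// ler_peMr// ler1n.
  rewrite -A2E; apply: le_trans (sum_jets_le (q := fun j k => M1 / eta ^+ k) cM bM) _.
  rewrite lerD2r mulr_sumr; apply: ler_sum => j _; rewrite mulr_sumr.
  by apply: ler_sum => k _; rewrite -[leLHS]mulrA.
have M1A2 : M1 * A2 = L * (G / n%:R) by rewrite /M1 /G; ring.
have Gn : G / n%:R <= 1 / 2.
  rewrite ler_pdivrMr//.
  have := archi_boundP (mulr_ge0 (ler0n R 2) G0).
  have : (Num.bound (2 * G))%:R <= n%:R :> R by rewrite ler_nat.
  lra.
(* The term [L * (G / n%:R)] is absorbed by the left-hand side. As [L > 0], the outcome forces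
   [c != 0]. *)
have L_le2 : L <= 2 * (nrm c * S N * A1).
  have := ler_wpM2l (ltW L0) Gn; rewrite -M1A2; lra.
have c0 : c != 0.
  apply: contraTneq L0 => c0; rewrite -leNgt (le_trans L_le2)//.
  by rewrite c0 nrm0 !mul0r mulr0.
have MLx (x : R) : 0 <= x -> M * L * (x / n%:R) <= nrm c * S N * (2 * A1 * (M * x) / n%:R).
  move=> x0.
  have -> : M * L * (x / n%:R) = L * (M * x / n%:R) by ring.
  have -> : nrm c * S N * (2 * A1 * (M * x) / n%:R) =
    2 * (nrm c * S N * A1) * (M * x / n%:R) by ring.
  by rewrite ler_wpM2r// divr_ge0 ?mulr_ge0// ltW.
exists c; split => // w wT.
  have -> : Q.[w] - c * (S N)%:C *
      \sum_(j < l) \sum_(k < s j) dominant_jet nu z s j k N * (hm j k).[w] =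
    \sum_(j < l) \sum_(k < s j) (c * ('C(N, k)%:R * z j ^+ (N - k) -
        (S N)%:C * dominant_jet nu z s j k N) + b j k) * (hm j k).[w].
    rewrite {1}QE horner_sum mulr_sumr -sumrB; apply: eq_bigr => j _.
    rewrite horner_sum mulr_sumr -sumrB; apply: eq_bigr => k _.
    by rewrite hornerZ; ring.
  apply: le_trans (sum_hermite_horner (fun j k => c * ('C(N, k)%:R * z j ^+ (N - k) -
        (S N)%:C * dominant_jet nu z s j k N) + b j k) wT) _.
  have cM j k : (j < l)%N -> (k < s j)%N ->
      nrm (c * ('C(N, k)%:R * z j ^+ (N - k) - (S N)%:C * dominant_jet nu z s j k N)) <=
      nrm c * (S N * (K j k / n%:R)).
    by move=> jl ks; rewrite nrmM ler_wpM2l ?nrm_ge0// KP.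
  apply: le_trans (sum_jets_le (q := fun j k => M1 / eta ^+ k) cM bM) _.
  rewrite A2E mulrDl mulrDr lerD//.
    rewrite [A3 / _]mulrC mulrA mulr_sumr; apply: ler_sum => j _.
    by rewrite mulr_sumr; apply: ler_sum => k _; rewrite le_eqVlt; apply/orP; left; apply/eqP; ring.
  have := MLx (Kt * A2) (mulr_ge0 Kt0 A20).
  have -> : M * L * (Kt * A2 / n%:R) = M1 * A2 by rewrite /M1; ring.
  by rewrite /G !mulrA.
(* The monomial is small against [S N] because [rho' < rho], and the tail is small against [L]. *)
have -> : g w * Q.[w] - D.[w] * P.[w] = c * w ^+ N + f w.
  by rewrite /f /F hornerM; ring.
rewrite (le_trans (nrmD _ _))// mulrDl mulrDr lerD//.
  rewrite nrmM nrmX -mulrA ler_wpM2l ?nrm_ge0//.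
  apply: le_trans (_ : rho ^+ N * (rho' / rho) ^+ N <= _).
    rewrite -exprMn [rho * _]mulrC divfK ?gt_eqF//.
    by rewrite lerXn2r ?nnegrE ?nrm_ge0.
  have [_ H] := KaP N N0.
  rewrite ler_pM ?exprn_ge0 ?divr_ge0 ?(ltW rho0) ?scale_ge//.
  exact: le_trans H (divN _ Ka0).
apply: le_trans (MLx _ Kb0); apply: le_trans (cP w _) _.
  by rewrite (le_trans wT)// ltW// (lt_trans rho'rho).
apply: (tail rho'); rewrite ?nrm_ge0//; first by rewrite ltW// (lt_trans rho'rho).
by have [] := KbP N N0.
Qed.

End DenominatorAsymptotics.

(** * Lower bound on omega and conclusion *)

Section OmegaBound.
Variable R : realType.
Lemma horner_continuous (p : {poly R[i]}) : continuous (fun w : R[i] => p.[w]).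
Proof.
elim/poly_ind: p => [|p c IH] w.
  have -> : (fun w : R[i] => (0 : {poly R[i]}).[w]) = cst 0 by apply/funext => x; rewrite horner0.
  exact: cst_continuous.
have -> : (fun w => (p * 'X + c%:P).[w]) = (fun w => p.[w] * w + c).
  by apply/funext => x; rewrite hornerMXaddC.
apply: (@continuousD _ _ _ (fun w : R[i] => p.[w] * w) (cst c)); last exact: cst_continuous.
apply: (@continuousM _ _ (fun w : R[i] => p.[w]) id); last exact: cvg_id.
exact: IH.
Qed.

Lemma continuous_bigsum (T : topologicalType) (I : Type) (r : seq I) (F : I -> T -> R[i]) :
  (forall i, continuous (F i)) -> continuous (fun x => \sum_(i <- r) F i x).
Proof.
move=> Fc; elim: r => [|i r IH] x.
  have -> : (fun x => \sum_(i <- [::]) F i x) = cst 0.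
    by apply/funext => y; rewrite big_nil.
  exact: cst_continuous.
have -> : (fun x => \sum_(j <- i :: r) F j x) = (fun x => F i x + \sum_(j <- r) F j x).
  by apply/funext => y; rewrite big_cons.
by apply: (@continuousD _ _ _ (F i) (fun x => \sum_(j <- r) F j x)); [exact: Fc|exact: IH].
Qed.

Lemma omega_continuous nu a l (z : nat -> R[i]) s :
  continuous (fun x : R[i] * 'rV[R[i]]_nu => nrm (omega a l z s x.1 x.2)).
Proof.
move=> x; apply: (@continuous_comp _ _ _
  (fun x : R[i] * 'rV[R[i]]_nu => omega a l z s x.1 x.2) (fun w => nrm w));
  last exact: nrm_continuous.
apply: continuous_bigsum => j {}x.
apply: (@continuousM _ _ (fun x : R[i] * 'rV[R[i]]_nu => constC a l z s j * (polyDeltaj nu z j).[x.1])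
  (fun x : R[i] * 'rV[R[i]]_nu => x.2 0 j)).
  apply: (@continuousM _ _ (cst _) (fun x : R[i] * 'rV[R[i]]_nu => (polyDeltaj nu z j).[x.1])).
    exact: cst_continuous.
  apply: (@continuous_comp _ _ _ fst (fun w : R[i] => (polyDeltaj nu z j).[w])).
    exact: cvg_fst.
  exact: horner_continuous.
apply: (@continuous_comp _ _ _ snd (fun t : 'rV[R[i]]_nu => t 0 j)).
  exact: cvg_snd.
exact: coord_continuous.
Qed.

Lemma compact_torus nu : compact (@torus R nu).
Proof.
have -> : @torus R nu = [set v | forall j, [set w : R[i] | `|w| = 1] (v ord0 j)] by [].
apply: (@rV_compact R[i] nu (fun=> [set w : R[i] | `|w| = 1])) => _.
apply: (subclosed_compact _ (@compact_disk R 1)); last first.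
  by move=> w /= w1; rewrite -lecR -nrmE w1.
have -> : [set w : R[i] | `|w| = 1] = (fun w => nrm w) @^-1` [set 1].
  apply/seteqP; split => w /=; first by move=> w1; apply: complexI.
  by rewrite nrmE => ->.
apply: closed_comp => [w _|]; first exact: nrm_continuous.
exact: closed_eq.
Qed.

Lemma nrm_expiz (t : R) (N : int) : nrm (expi t ^ N) = 1.
Proof. by case: N => n; rewrite /exprz ?nrmV nrmX nrm_expi expr1n ?invr1. Qed.

(** The product of [K] and [groupF] is compact, so the modulus of omega attains its minimum there,
    which is positive as [K] avoids [setNF]. Taking the closure of the powers of xi is what makes
    the bound uniform in [N]. *)
Lemma omega_lower_bound nu a l (z : nat -> R[i]) s Theta (K : set R[i]) :
  compact K -> (forall w, K w -> ~ setNF a l nu z s Theta w) ->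
  exists2 delta : R, 0 < delta & forall w N, K w ->
    delta <= nrm (omega a l z s w (@xi_pow R nu Theta N)).
Proof.
move=> cK KN.
have cF : compact (@groupF R nu Theta).
  by apply: compact_closedI; [exact: compact_torus|exact: closed_closure].
have cKF := compact_setX cK cF.
have xiF N : @groupF R nu Theta (xi_pow nu Theta N).
  split; last by apply: subset_closure; exists N.
  by move=> j; rewrite mxE nrmE nrm_expiz.
have [[w0 Kw0]|K0] := pselect (K !=set0); last first.
  by exists 1 => // w N Kw; case: K0; exists w.
have [||[w1 t1] /set_mem[/= Kw1 Ft1] H] := compact_EVT_min _ cKF (f := fun x => nrm (omega a l z s x.1 x.2)) _.
- by exists (w0, xi_pow nu Theta 0); split => //; exact: xiF.
- by apply: continuous_subspaceT; exact: omega_continuous.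
exists (nrm (omega a l z s w1 t1)) => [|w N Kw].
  rewrite nrm_gt0; apply/eqP => w1t1; apply: (KN _ Kw1); by exists t1.
have KFw : (K `*` @groupF R nu Theta) (w, xi_pow nu Theta N).
  by split; [exact: Kw|exact: xiF].
exact: H _ (mem_set KFw).
Qed.

Lemma poly_bounds (p : {poly R[i]}) (K : set R[i]) : compact K ->
  exists2 B : R, 0 < B & forall w, K w -> nrm p.[w] <= B.
Proof.
move=> cK; have [[w0 Kw0]|K0] := pselect (K !=set0); last first.
  by exists 1 => // w Kw; case: K0; exists w.
have [||w1 _ H] := compact_EVT_max _ cK (f := fun w => nrm p.[w]) _.
- by exists w0.
- by apply: regular_within_continuous => w _; exact: regular_poly.
exists (nrm p.[w1] + 1); first by rewrite ltr_wpDl ?nrm_ge0.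
by move=> w Kw; rewrite (le_trans (H w (mem_set Kw)))// lerDl.
Qed.

Lemma poly_lower_bound (p : {poly R[i]}) (K : set R[i]) : compact K ->
  (forall w, K w -> p.[w] != 0) ->
  exists2 d : R, 0 < d & forall w, K w -> d <= nrm p.[w].
Proof.
move=> cK pK; have [[w0 Kw0]|K0] := pselect (K !=set0); last first.
  by exists 1 => // w Kw; case: K0; exists w.
have [||w1 /set_mem Kw1 H] := compact_EVT_min _ cK (f := fun w => nrm p.[w]) _.
- by exists w0.
- by apply: regular_within_continuous => w _; exact: regular_poly.
exists (nrm p.[w1]); first by rewrite nrm_gt0 pK.
by move=> w Kw; apply: H; exact: mem_set.
Qed.

Lemma compact_in_disk (K : set R[i]) (rho : R) : 0 < rho -> compact K ->
  (forall w, K w -> nrm w < rho) ->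
  exists2 rho' : R, 0 <= rho' < rho & forall w, K w -> nrm w <= rho'.
Proof.
move=> r0 cK Kr; have [[w0 Kw0]|K0] := pselect (K !=set0); last first.
  by exists 0 => [|w Kw]; [rewrite lexx|case: K0; exists w].
have [||w1 /set_mem Kw1 H] := compact_EVT_max _ cK (f := fun w => nrm w) _.
- by exists w0.
- by apply: continuous_subspaceT; exact: nrm_continuous.
exists (nrm w1); first by rewrite nrm_ge0 Kr.
by move=> w Kw; apply: H; exact: mem_set.
Qed.

Lemma uniform_cvg_complexP (K : set R[i]) (F : nat -> R[i] -> R[i]) (f : R[i] -> R[i]) :
  (forall e : R, 0 < e -> \forall n \near \oo, forall w, K w -> nrm (f w - F n w) < e) ->
  {uniform K, F @ \oo --> f}.
Proof.
move=> H A /uniform_nbhs[B [entB BA]].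
move: entB; rewrite -entourage_ballE => -[e /= /gt0_complexE[e0 eE] eB].
have := H _ e0; apply: filterS => n Hn.
apply: BA => w Kw; apply: eB; rewrite /= -ball_normE /ball_ /= nrmE eE ltcR.
exact: Hn.
Qed.

Lemma bigO_complexP (f : R[i] -> R[i]) n : f =O_ (nbhs (0 : R[i])) (fun w : R[i] => w ^+ n) ->
  exists B e : R, 0 < e /\ forall h, nrm h < e -> nrm (f h) <= B * nrm h ^+ n.
Proof.
move=> /eqO_exP[k k0 /near_complexP[e e0 eP]].
exists (complex.Re k), e; split => // h /eP; rewrite add0r.
have [_ ->] := gt0_complexE k0; rewrite !nrmE nrmX -rmorphM lecR.
by [].
Qed.
End OmegaBound.

Lemma near_div_le (R : realType) (n0 : nat) (x y : R) : 0 <= x -> 0 < y ->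
  \forall n \near \oo, [/\ (n0 <= n)%N, (0 < n)%N & x / n%:R <= y].
Proof.
move=> x0 y0; exists (n0 + (Num.bound (x / y)).+1)%N => // n /= nn.
have n1 : (0 < n)%N by lia.
split => //; first by lia.
rewrite ler_pdivrMr ?ltr0n// mulrC -ler_pdivrMr//.
have := archi_boundP (divr_ge0 x0 (ltW y0)) => /ltW/le_trans; apply.
by rewrite ler_nat (leq_trans _ nn)// addnS leqW// leq_addl.
Qed.

(** * The dominant term as a multiple of omega *)

Section DominantTerm.
Variables (R : realType) (a : R[i] -> R[i]) (l mu nu : nat) (z : nat -> R[i]) (s : nat -> nat).
Variable Theta : nat -> R.
Hypothesis numbering : pole_numbering l mu nu z s.
Hypothesis zinj : forall i j, (i < l)%N -> (j < l)%N -> z i = z j -> i = j.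
Hypothesis s_gt0 : forall j, (j < l)%N -> (0 < s j)%N.
Hypothesis z_neq0 : forall j, (j < l)%N -> z j != 0.
Hypothesis z_arg : forall j, (j < nu)%N ->
  z j = max_modulus z * expi (2 * pi * Theta j).
Hypothesis a_coef : forall j, (j < l)%N -> laurent_coef a (z j) (- (s j)%:Z) != 0.
Variable g : R[i] -> R[i].
Hypothesis g_pole : forall j, (j < l)%N ->
  g (z j) = (polyDj l z s j).[z j] * laurent_coef a (z j) (- (s j)%:Z).
Variable E : nat -> {poly R[i]}.
Hypothesis EP : forall j : 'I_l,
  ('X - (z j)%:P) ^+ s j %| E j - 1 /\ polyDj l z s j %| E j.
Variable V : {poly R[i]}.
Hypothesis Vz : forall j : 'I_l, V.[z j] = (g (z j))^-1.

Lemma g_pole_neq0 j : (j < l)%N -> g (z j) != 0.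
Proof.
by move=> jl; rewrite g_pole// mulf_neq0 ?a_coef// (polyDj_neq0 s (Ordinal jl) zinj).
Qed.

(** At a dominant pole, [('X - (z j)%:P) ^+ (s j).-1 * D_j] is [D / ('X - (z j)%:P)], that is
    [(D / Delta) * Delta_j]. The constants of [dominant_jet] and of [hermite_dominant] multiply to
    C_j. *)
Lemma dominant_term w N : (forall j, (j < l)%N -> w != z j) ->
  \sum_(j < l) \sum_(k < s j) dominant_jet nu z s j k N * (hermite l z s E V j k).[w] =
  (polyD l z s).[w] / (polyDelta nu z).[w] * omega a l z s w (xi_pow nu Theta N).
Proof.
move=> wz; have nul : (nu <= l)%N by exact: leq_trans (nu_le_mu numbering) (mu_le_l numbering).
have rho0 := rho_gt0 numbering z_neq0.
have rhoC0 : (nrm (z 0%N))%:C != 0 :> R[i].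
  by rewrite -nrm_eq0 nrm_real gtr0_norm// gt_eqF.
pose X j := dominant_jet nu z s j (s 0%N).-1 N *
  (hermite l z s E V j (s 0%N).-1).[w].
transitivity (\sum_(j < l | (j < nu)%N) X j).
  rewrite [RHS]big_mkcond; apply: eq_bigr => j _.
  case: ifPn => jnu; last first.
    by apply: big1 => k _; rewrite /dominant_jet (negbTE jnu) mul0r.
  have sj := mult_max numbering jnu; have sj0 := s_gt0 (ltn_ord j).
  have ms : ((s 0%N).-1 < s j)%N by rewrite sj prednK -?sj.
  rewrite (bigD1 (Ordinal ms))//= big1 => [|k km]; first exact: addr0.
  rewrite /dominant_jet (_ : (k == _ :> nat) = false) ?andbF ?mul0r//.
  by apply/negP => /eqP kE; move/eqP: km; apply; apply: val_inj.
rewrite -(big_ord_widen l X nul) mulr_sumr; apply: eq_bigr => j _.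
have jl : (j < l)%N by rewrite (leq_trans (ltn_ord j)).
pose o := Ordinal jl; have sj := mult_max numbering (ltn_ord j).
have wzj : w - z j != 0 by rewrite subr_eq0 wz.
have DeltaE : polyDelta nu z = ('X - (z j)%:P) * polyDeltaj nu z j.
  by rewrite /polyDeltaj /polyDelta (bigD1 j)//= mulKp// polyXsubC_eq0.
have Delta0 : (polyDelta nu z).[w] != 0.
  rewrite /polyDelta horner_prod; apply/prodf_neq0 => i _.
  by rewrite hornerXsubC subr_eq0 wz// (leq_trans (ltn_ord i)).
have Deltaj0 : (polyDeltaj nu z j).[w] != 0.
  by move: Delta0; rewrite DeltaE hornerM mulf_eq0 negb_or => /andP[].
have tauE : (xi_pow nu Theta N) 0 j = (z j / (nrm (z 0%N))%:C) ^+ N.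
  rewrite mxE [z j]z_arg// /max_modulus nrmE (mulrAC (nrm _)%:C) divff// mul1r.
  by [].
rewrite tauE /X /dominant_jet ltn_ord eqxx /= -sj.
rewrite (hermite_dominant zinj s_gt0 EP g_pole_neq0 Vz o) /=.
rewrite hornerZ hornerM horner_exp hornerXsubC g_pole//.
rewrite (polyD_factor _ _ o) DeltaE !hornerM horner_exp !hornerXsubC /=.
have -> : (w - z j) ^+ s j = (w - z j) ^+ (s j).-1 * (w - z j).
  by rewrite -exprSr prednK// s_gt0.
have Dj0 := polyDj_neq0 s o zinj.
have A0 := a_coef jl; have zj0 := z_neq0 jl.
rewrite /constC; field.
have f0 : (((s j).-1)`!%:R : R[i]) != 0 by rewrite pnatr_eq0 -lt0n fact_gt0.
by rewrite ?wzj ?Deltaj0 ?A0 ?f0 ?expf_neq0 ?Dj0.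
Qed.

End DominantTerm.

Theorem theorem2 (R : realType) (r : R) (a : R[i] -> R[i])
    (l mu nu lambda : nat) (z : nat -> R[i]) (s : nat -> nat) (Theta : nat -> R)
    (P Q : nat -> {poly R[i]})
    (a_meromorphic : meromorphic_in_disk a r)
    (a_analytic0 : analytic_at a 0)
    (a_poles : poles_in_disk a r l z s)
    (lambdaE : lambda = (\sum_(i < l) s i)%N)
    (lambda_ge1 : (1 <= lambda)%N)
    (z_numbering : pole_numbering l mu nu z s)
    (z_arg : forall j, (j < nu)%N ->
       z j = max_modulus z * expi (2 * pi * Theta j))
    (PQ_pade : forall n, is_pade a n lambda.-1 (P n) (Q n)) :
  forall K : set R[i], compact K -> K `<=` setUF a l mu nu z s Theta ->
    (\forall n \near \oo, forall w, K w -> ~ ratfun_pole (P n) (Q n) w) /\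
    {uniform K, (fun n => ratfun_eval (P n) (Q n)) @ \oo --> a}.
Proof.
move=> K cK KU.
have [zinj polesP] := a_poles.
have poleP j : (j < l)%N -> nrm (z j) < r /\ pole_of_order a (z j) (s j).
  move=> jl; have [zr pj] := (polesP (z j) (s j)).2 (ex_intro2 _ _ j jl (conj erefl erefl)).
  by split => //; rewrite -ltcR.
have s_gt0 j : (j < l)%N -> (0 < s j)%N by move=> /poleP[_ []].
have z_neq0 j : (j < l)%N -> z j != 0.
  move=> /poleP[_]; apply: contraPneq => ->.
  exact: pole_not_regular (analytic_regular a_analytic0).
have l0 := l_gt0 z_numbering.
set rho := nrm (z 0%N); have rho0 : 0 < rho := rho_gt0 z_numbering z_neq0.
have rhor : rho < r by have [] := poleP _ l0.
pose T := (rho + r) / 2.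
have rhoT : rho < T by rewrite /T; lra.
have Tr : T < r by rewrite /T; lra.
have [g [g_reg g_out g_pole a_coef]] := cleared_function a_meromorphic a_poles.
have gT w : nrm w <= T -> regular_at g w.
  by move=> wT; apply: g_reg; exact: le_lt_trans Tr.
have g_regz j : (j < l)%N -> regular_at g (z j) by move=> /poleP[/g_reg].
have g_neq0 := g_pole_neq0 zinj a_coef g_pole.
have [E EP] := crt_idempotents s zinj.
have [U [V [U_jet VU Vz]]] := jet_inverse s_gt0 EP g_regz g_neq0.
have [K1 K10 [n0 core]] :=
  denominator_asymptotics z_numbering zinj s_gt0 z_neq0 rhoT gT EP U_jet VU.
have Krho w : K w -> nrm w < rho by move=> /KU[/= wr _]; rewrite -ltcR.
have [rho' rho'P Krho'] := compact_in_disk rho0 cK Krho.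
(* The poles of maximal modulus are excluded by the disk, the inner ones by the definition of
   [setUF]. *)
have Kz w j : K w -> (j < l)%N -> w != z j.
  move=> Kw jl; apply/eqP => wzj.
  have [jmu|muj] := ltnP j mu.
    by have := Krho w Kw; rewrite wzj (modulus_maxE z_numbering jmu) ltxx.
  by have [_ /= []] := KU w Kw; right; exists j => //; rewrite muj.
have [delta delta0 deltaP] : exists2 delta : R, 0 < delta & forall w N, K w ->
    delta <= nrm (omega a l z s w (@xi_pow R nu Theta N)).
  apply: omega_lower_bound => // w /KU[_ wN] wNF; apply: wN; by left.
have [d0 d00 d0P] : exists2 d : R, 0 < d & forall w, K w -> d <= nrm (polyD l z s).[w].
  by apply: poly_lower_bound => // w Kw; apply: polyD_neq0 => j; exact: Kz.
have [B B0 BP] := poly_bounds (polyDelta nu z) cK.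
have [K2 K20 {}core] := core _ rho'P.
have [BD BD0 BDP] := poly_bounds (polyD l z s) (@compact_disk R 1).
have [e0 e00 e0P] := separation l z 0.
have nul : (nu <= l)%N by exact: leq_trans (nu_le_mu z_numbering) (mu_le_l z_numbering).
(* A lower bound of the modulus of [D / Delta * omega] on [K], uniform in [n]. *)
pose delta' := d0 / B * delta.
have delta'0 : 0 < delta' by rewrite mulr_gt0 ?divr_gt0.
have D0 : 0 < d0 * (delta' / 2) by rewrite mulr_gt0// divr_gt0.
have padeP n : (n0 <= n)%N -> (0 < n)%N -> K1 / n%:R <= delta' / 2 ->
  forall w, K w -> (Q n).[w] != 0 /\
    nrm (a w - (P n).[w] / (Q n).[w]) <= K2 / n%:R / (d0 * (delta' / 2)).
  move=> n0n n1 nK1 w Kw.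
  have [sP sQ Qn0 /bigO_complexP[C [e [e1 PQ]]]] := PQ_pade n.
  (* [e'] keeps [h] in the range of the Padé condition, off the poles, where [g] is [D] times [a],
     and in the unit disk, where [BD] bounds [D]. *)
  pose e' := Num.min (e / 2) (Num.min e0 1).
  have e'0 : 0 < e' by rewrite !lt_min divr_gt0 ?e00/=.
  have sQ' : (size (Q n) <= \sum_(i < l) s i)%N.
    by rewrite -lambdaE -(prednK lambda_ge1).
  have HPQ h : h != 0 -> nrm h <= e' ->
      nrm (g h * (Q n).[h] - (polyD l z s).[h] * (P n).[h]) <=
      BD * C * nrm h ^+ (n + \sum_(i < l) s i).
    move=> h0; rewrite !le_min => /andP[he /andP[he0 h1]].
    rewrite g_out => [|j jl]; last first.
      apply/eqP => hz; have := e0P j jl; rewrite -hz subr0 h0 => /(_ isT).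
      by rewrite ltNge he0.
    rewrite -(mulrA (polyD l z s).[h]) -mulrBr nrmM -(mulrA BD).
    rewrite ler_pM ?nrm_ge0// ?BDP//.
    rewrite -lambdaE (_ : (n + lambda)%N = (n + lambda.-1 + 1)%N); last first.
      by rewrite -addnA addn1 prednK.
    by apply: PQ; rewrite (le_lt_trans he)// ltr_pdivrMr// mulr_natr mulr2n ltrDl.
  have [c [c0 cQ cgQ]] := core n _ (P n) (Q n) (BD * C) e' n0n n1 erefl sP sQ' Qn0 e'0 HPQ.
  set N := (n + _)%N in cQ cgQ.
  have Sp : 0 < scale (s 0%N).-1 rho N.
    rewrite scale_gt0// /N (leq_trans (leq_pred _))// (leq_trans _ (leq_addl _ _))//.
    exact: s_le_lambda l0.
  have cS : 0 < nrm c * scale (s 0%N).-1 rho N by rewrite mulr_gt0 ?nrm_gt0.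
  have wrho := Krho w Kw.
  have := cQ w (ltW (lt_trans wrho rhoT)).
  rewrite (dominant_term z_numbering zinj s_gt0 z_neq0 z_arg a_coef g_pole EP Vz) => [|j]; last exact: Kz.
  set main := _ / _ * _ => Qmain.
  have mainP : delta' <= nrm main.
    rewrite !nrmM nrmV ler_pM ?deltaP ?divr_ge0 ?(ltW d00) ?(ltW B0) ?(ltW delta0)//.
    rewrite ler_pM ?invr_ge0 ?(ltW d00) ?(ltW B0) ?d0P//.
    rewrite lef_pV2 ?posrE ?BP// nrm_gt0 /polyDelta horner_prod.
    apply/prodf_neq0 => i _; rewrite hornerXsubC subr_eq0 Kz//.
    by rewrite (leq_trans (ltn_ord i)).
  clearbody main.
  (* The error is at most half the lower bound of the main term, so the other half remains. *)
  have Qlow : nrm c * scale (s 0%N).-1 rho N * (delta' / 2) <= nrm (Q n).[w].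
    have := nrm_le_sub (c * (scale (s 0%N).-1 rho N)%:C * main) (Q n).[w].
    rewrite nrmBC !(nrmM, nrm_real) (gtr0_norm Sp).
    have := ler_wpM2l (ltW cS) mainP; have := ler_wpM2l (ltW cS) nK1.
    move: Qmain; lra.
  have Qpos : 0 < nrm (Q n).[w] by rewrite (lt_le_trans _ Qlow)// mulr_gt0// divr_gt0.
  have Qw0 : (Q n).[w] != 0 by rewrite -nrm_gt0.
  have Dw0 : (polyD l z s).[w] != 0 by apply: polyD_neq0 => j; exact: Kz.
  split => //.
  have -> : a w - (P n).[w] / (Q n).[w] =
      (g w * (Q n).[w] - (polyD l z s).[w] * (P n).[w]) / ((polyD l z s).[w] * (Q n).[w]).
    rewrite g_out => [|j]; last exact: Kz.
    by field; rewrite Qw0 Dw0.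
  rewrite nrmM nrmV nrmM ler_pdivrMr ?mulr_gt0 ?nrm_gt0//.
  rewrite (le_trans (cgQ w (Krho' w Kw)))//.
  apply: le_trans (_ : K2 / n%:R / (d0 * (delta' / 2)) *
    (d0 * (nrm c * scale (s 0%N).-1 rho N * (delta' / 2))) <= _).
    rewrite le_eqVlt; apply/orP; left; apply/eqP; field.
    by rewrite !gt_eqF ?ltr0n.
  apply: ler_wpM2l.
    by apply: divr_ge0; [exact: divr_ge0|exact: ltW].
  apply: (ler_pM _ _ _ Qlow); [exact: ltW| |exact: d0P].
  by rewrite mulr_ge0 ?(ltW cS)// divr_ge0// ltW.
(* [P n] and [Q n] may have common factors; where [Q n] does not vanish neither does their gcd, and
   the reduced fraction takes the same value. *)
have evalE n w : (Q n).[w] != 0 ->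
    ~ ratfun_pole (P n) (Q n) w /\ ratfun_eval (P n) (Q n) w = (P n).[w] / (Q n).[w].
  rewrite /ratfun_pole /ratfun_eval; set G := gcdp _ _.
  have -> : (Q n).[w] = (Q n %/ G).[w] * G.[w] by rewrite -hornerM divpK ?dvdp_gcdr.
  have -> : (P n).[w] = (P n %/ G).[w] * G.[w] by rewrite -hornerM divpK ?dvdp_gcdl.
  rewrite mulf_eq0 negb_or => /andP[Qw Gw]; split; first exact/negP.
  by field; rewrite Qw Gw.
have near1 := near_div_le n0 K10 (divr_gt0 delta'0 (ltr0Sn R 1)).
split.
  apply: filterS near1 => n [nn n1 nK] w Kw.
  by have [/evalE[]] := padeP n nn n1 nK w Kw.
apply: uniform_cvg_complexP => eps eps0.
(* Half of [eps], since [near_div_le] gives a large inequality and a strict one is required. *)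
have near2 := near_div_le n0 K20 (mulr_gt0 (divr_gt0 eps0 (ltr0Sn R 1)) D0).
apply: filterS2 near1 near2 => n [nn n1 nK] [_ _ nK2] w Kw.
have [Qw H] := padeP n nn n1 nK w Kw.
have [_ ->] := evalE n w Qw; rewrite (le_lt_trans H)//.
by rewrite (le_lt_trans _ (_ : eps / 2 < eps))//; [rewrite ler_pdivrMr|lra].
Qed.
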